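(* Let $G$ and $G^*$ be countable graphs, each finitely separable, defined on the same edge set $E$, such that $G^*$ is a dual of $G$ with the identity map $E\to E$ as witnessing bijection. Then $$M_{\rm FB}(G)=M_{\rm C}^*(G)=M_{\rm B}^*(G^* )=M_{\rm FC}(G^* ).$$
   Context: Matroids may be infinite (defined by: $\emptyset$ independent; independent sets closed under subsets; for a non-maximal independent $I$ and maximal independent $I'$ some $x\in I'\setminus I$ has $I\cup\{x\}$ independent; and for every independent $I\subseteq X\subseteq E$ there is a maximal independent set $I'$ with $I\subseteq I'\subseteq X$). Circuits are minimal dependent sets; $M^*$ denotes the dual matroid, whose bases are the complements of the bases of $M$. Graphs may have parallel edges and loops. A graph is finitely separable if any two vertices can be separated by removing finitely many edges. A cut is the set of edges across a partition of the vertex set; a bond is a minimal non-empty cut. $M_{\rm FC}(H)$: the matroid on $E(H)$ whose circuits are the edge sets of finite cycles of $H$. $M_{\rm FB}(H)$: circuits are the finite bonds of $H$. $M_{\rm B}(H)$: circuits are all bonds of $H$. $M_{\rm C}(H)$: circuits are the edge sets of circles in $|H|$. The space $|H|$: rays are one-way infinite paths; two rays are edge-equivalent if for every finite edge set $F$ some component of $H-F$ contains subrays of both; classes are edge-ends. Viewing edges as copies of $[0,1]$ glued at common vertices gives a space $X_H$; $|H|$ has point set $X_H$ together with the edge-ends, and its open sets are unions of sets $\widetilde C$, where $C$ is a component of $X_H\setminus Z$ for a finite set $Z$ of inner points of edges and $\widetilde C$ adds to $C$ the edge-ends having a ray in $C$. A circle is a subspace homeomorphic to $S^1$; its edge set is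 the set of edges all of whose inner points lie in it. A graph $G^*$ is a dual of $G$ if there is a bijection ${}^*:E(G)\to E(G^* )$ such that $F\subseteq E(G)$ is the edge set of a circle in $|G|$ if and only if $\{e^*: e\in F\}$ is a bond of $G^*$. *)

(* Defs.v *)
From Stdlib Require Import Reals List Arith.
Open Scope R_scope.

Set Implicit Arguments.

Section Matroids.
Variable E : Type.

Definition eset := E -> Prop.
Definition subset (X Y : eset) : Prop := forall e, X e -> Y e.

Definition is_base (I : eset -> Prop) (B : eset) : Prop :=
  I B /\ forall B', I B' -> subset B B' -> subset B' B.

Definition is_max_indep_in (I : eset -> Prop) (Y B : eset) : Prop :=
  I B /\ subset B Y /\ forall B', I B' -> subset B B' -> subset B' Y -> subset B' B.

Definition is_matroid (I : eset -> Prop) : Prop :=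
  I (fun _ => False) /\
  (forall X Y, I Y -> subset X Y -> I X) /\
  (forall X Y, I X -> ~ is_base I X -> is_base I Y ->
     exists x, Y x /\ ~ X x /\ I (fun e => X e \/ e = x)) /\
  (forall X Y, I X -> subset X Y ->
     exists B, subset X B /\ is_max_indep_in I Y B).

(* the independence system whose circuits are the members of C *)
Definition indep_of (C : eset -> Prop) : eset -> Prop :=
  fun X => forall D, C D -> ~ subset D X.

(* dual: bases of the dual are the complements of the bases *)
Definition dual (I : eset -> Prop) : eset -> Prop :=
  fun X => exists B, is_base I B /\ forall e, X e -> ~ B e.

Definition same_matroid (I1 I2 : eset -> Prop) : Prop :=
  forall X, I1 X <-> I2 X.

Definition finite_set (X : eset) : Prop :=
  exists l : list E, forall e, X e -> In e l.
End Matroids.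

Definition countable (T : Type) : Prop :=
  exists f : T -> nat, forall x y, f x = f y -> x = y.

(* Multigraphs (loops and parallel edges allowed): vertex type V, edge
   type E, each edge e has endpoints ends e (an edge is a copy of [0,1]
   with 0 at fst (ends e) and 1 at snd (ends e)).                       *)
Section Graphs.
Variables (V E : Type) (ends : E -> V * V).

Definition joins (e : E) (u v : V) : Prop :=
  ends e = (u, v) \/ ends e = (v, u).

Inductive reach (F : E -> Prop) (u : V) : V -> Prop :=
| reach_refl : reach F u u
| reach_step : forall v w e, reach F u v -> ~ F e -> joins e v w -> reach F u w.

Definition finitely_separable : Prop :=
  forall u v : V, u <> v ->
    exists F : list E, ~ reach (fun e => In e F) u v.

Definition is_cut (F : eset E) : Prop :=
  exists A : V -> Prop, forall e,
    F e <-> (A (fst (ends e)) /\ ~ A (snd (ends e)) \/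
             ~ A (fst (ends e)) /\ A (snd (ends e))).

Definition is_bond (F : eset E) : Prop :=
  is_cut F /\ (exists e, F e) /\
  forall F', is_cut F' -> (exists e, F' e) -> subset F' F -> subset F F'.

Definition is_finite_bond (F : eset E) : Prop := is_bond F /\ finite_set F.

Definition is_finite_cycle_edges (F : eset E) : Prop :=
  exists (k : nat) (vs : nat -> V) (es : nat -> E),
    (0 < k)%nat /\
    (forall i j, (i < k)%nat -> (j < k)%nat -> vs i = vs j -> i = j) /\
    (forall i j, (i < k)%nat -> (j < k)%nat -> es i = es j -> i = j) /\
    (forall i, (i < k)%nat -> joins (es i) (vs i) (vs ((S i) mod k))) /\
    (forall e, F e <-> exists i, (i < k)%nat /\ es i = e).

Definition ray : Type := ((nat -> V) * (nat -> E))%type.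

Definition is_ray (r : ray) : Prop :=
  (forall m n, fst r m = fst r n -> m = n) /\
  (forall n, joins (snd r n) (fst r n) (fst r (S n))).

Definition ray_equiv (r1 r2 : ray) : Prop :=
  forall F : list E, exists n,
    (forall m, (n <= m)%nat -> ~ In (snd r1 m) F /\ ~ In (snd r2 m) F) /\
    reach (fun e => In e F) (fst r1 n) (fst r2 n).

Definition edge_end : Type :=
  { S : ray -> Prop | exists r, is_ray r /\
      forall r', S r' <-> (is_ray r' /\ ray_equiv r r') }.

(* points of |H|: vertices, inner points of edges (e,t) with 0<t<1,
   and edge-ends *)
Inductive point : Type :=
| PV : V -> point
| PE : E -> R -> point
| PEnd : edge_end -> point.

Definition valid (p : point) : Prop :=
  match p with PE _ t => 0 < t < 1 | _ => True end.

Definition validZ (Z : list (E * R)) : Prop :=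
  forall z, In z Z -> 0 < snd z < 1.

Definition inXZ (Z : list (E * R)) (x : point) : Prop :=
  match x with
  | PV _ => True
  | PE e t => 0 < t < 1 /\ ~ In (e, t) Z
  | PEnd _ => False
  end.

Definition cutE (Z : list (E * R)) (e : E) : Prop := exists t, In (e, t) Z.

(* x lies in the component of X_H \ Z containing vertex v via its edge *)
Definition anchor (Z : list (E * R)) (x : point) (v : V) : Prop :=
  match x with
  | PV u => u = v
  | PE e t =>
      (fst (ends e) = v /\ forall s, In (e, s) Z -> t < s) \/
      (snd (ends e) = v /\ forall s, In (e, s) Z -> s < t)
  | PEnd _ => False
  end.

(* same connected component of X_H \ Z *)
Definition samecomp (Z : list (E * R)) (x y : point) : Prop :=
  inXZ Z x /\ inXZ Z y /\
  ((exists u v, anchor Z x u /\ anchor Z y v /\ reach (cutE Z) u v) \/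
   (exists e s t, x = PE e s /\ y = PE e t /\
      forall r, In (e, r) Z -> ~ (Rmin s t <= r <= Rmax s t))).

Definition ray_in (Z : list (E * R)) (x0 : point) (r : ray) : Prop :=
  (forall n, samecomp Z x0 (PV (fst r n))) /\
  (forall n t, 0 < t < 1 -> samecomp Z x0 (PE (snd r n) t)).

(* the basic open set C~ where C is the component of X_H \ Z containing x0 *)
Definition basic (Z : list (E * R)) (x0 : point) (p : point) : Prop :=
  match p with
  | PEnd w => exists r, proj1_sig w r /\ ray_in Z x0 r
  | _ => samecomp Z x0 p
  end.

Definition openH (U : point -> Prop) : Prop :=
  forall p, U p -> exists Z x0, validZ Z /\ inXZ Z x0 /\ basic Z x0 p /\
    forall q, basic Z x0 q -> U q.

Definition S1 : Type := { p : R * R | fst p ^ 2 + snd p ^ 2 = 1 }.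

Definition openS1 (U : S1 -> Prop) : Prop :=
  forall x, U x -> exists eps, 0 < eps /\ forall y : S1,
    Rabs (fst (proj1_sig x) - fst (proj1_sig y)) < eps ->
    Rabs (snd (proj1_sig x) - snd (proj1_sig y)) < eps -> U y.

Definition is_circle (S : point -> Prop) : Prop :=
  exists f : S1 -> point,
    (forall x, valid (f x)) /\
    (forall x y, f x = f y -> x = y) /\
    (forall U, openH U -> openS1 (fun x => U (f x))) /\
    (forall U, openS1 U -> exists W, openH W /\ forall x, U x <-> W (f x)) /\
    (forall p, S p <-> exists x, f x = p).

Definition is_circle_edges (F : eset E) : Prop :=
  exists S, is_circle S /\
    forall e, F e <-> (forall t, 0 < t < 1 -> S (PE e t)).
End Graphs.

Definition is_dual_id (V Vs E : Type) (ends : E -> V * V) (endss : E -> Vs * Vs) :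
  Prop :=
  forall F : eset E, is_circle_edges ends F <-> is_bond endss F.

Definition M_FC V E (ends : E -> V * V) := indep_of (is_finite_cycle_edges ends).
Definition M_FB V E (ends : E -> V * V) := indep_of (is_finite_bond ends).
Definition M_B V E (ends : E -> V * V) := indep_of (is_bond ends).
Definition M_C V E (ends : E -> V * V) := indep_of (is_circle_edges ends).

(* Main.v *)
Require Import Defs.
From Stdlib Require Import Reals List Arith Lia Lra Classical ClassicalEpsilon.
From Stdlib Require Import ProofIrrelevance PropExtensionality FunctionalExtensionality.

(** In any graph an edge set contains no bond iff its complement connects the two
    ends of every edge; hence the bases of M_B are the complements of the maximal
    forests, and M_B and M_FC are matroids dual to each other. Duality of G and G*
    says that M_C(G) = M_B(G* ), so everything reduces to M_FB(G) = M_FC(G* ).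

    - A finite bond F of G contains a cycle of G*: if F were a forest of G*, then
      some bond of G*, that is, the edge set of a circle in |G|, would meet F in
      a single edge e. The circle with an inner point of e deleted is connected,
      but the two sides of F separate it.
    - A finite cycle D of G* contains a finite bond of G: otherwise the ends of
      some e in D are connected in G - D, which gives a finite cycle of G that
      meets D only in e. By finite separability this cycle is a circle in |G|,
      hence a bond of G*; but a cycle and a cut never share just one edge. *)

Set Implicit Arguments.

Local Open Scope nat_scope.

(** * Connectivity, cycles and bonds *)

Section Connectivity.
Variables (V E : Type) (ends : E -> V * V).

(** The set given to [reach] consists of the deleted edges, so walking inside [X] means deleting its
    complement. *)
Definition conn (X : eset E) : V -> V -> Prop := reach ends (fun e => ~ X e).

(** This is membership of [e] in the closure of [X] in the cycle matroid. *)
Definition spans (X : eset E) (e : E) : Prop :=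
  conn X (fst (ends e)) (snd (ends e)).

Lemma joins_sym e u v : joins ends e u v -> joins ends e v u.
Proof. unfold joins; tauto. Qed.

Lemma joins_ends e : joins ends e (fst (ends e)) (snd (ends e)).
Proof. left; apply surjective_pairing. Qed.

Lemma reach_trans F u v w :
  reach ends F u v -> reach ends F v w -> reach ends F u w.
Proof. intros H1 H2; induction H2; eauto using reach_step. Qed.

Lemma reach_sym F u v : reach ends F u v -> reach ends F v u.
Proof.
  intros H; induction H as [|v w e H IH Fe J]; [constructor|].
  apply reach_trans with v; [|exact IH].
  eapply reach_step; [constructor|exact Fe|now apply joins_sym].
Qed.

Lemma reach_mono (F F' : E -> Prop) u v :
  (forall e, F' e -> F e) -> reach ends F u v -> reach ends F' u v.
Proof. intros S H; induction H; [constructor|]; eauto using reach_step. Qed.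

(** Mostly applied with [A] one side of a cut: a walk that avoids the cut stays on its side. *)
Lemma reach_invariant (F : E -> Prop) (A : V -> Prop) u v :
  (forall e, ~ F e -> (A (fst (ends e)) <-> A (snd (ends e)))) ->
  reach ends F u v -> (A u <-> A v).
Proof.
  intros S H; induction H as [|v w e H IH Fe J]; [tauto|].
  specialize (S e Fe); destruct J as [J|J]; rewrite J in S; simpl in S; tauto.
Qed.

Lemma conn_mono (X Y : eset E) u v : subset X Y -> conn X u v -> conn Y u v.
Proof. intros S; apply reach_mono; intros e NY Xe; auto. Qed.

Lemma conn_edge (X : eset E) e u v : X e -> joins ends e u v -> conn X u v.
Proof. intros Xe J; apply (reach_step (v := u) (e := e)); [constructor|tauto|exact J]. Qed.

Lemma spans_joins (X : eset E) e u v : spans X e -> joins ends e u v -> conn X u v.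
Proof.
  unfold spans; intros H [J|J]; rewrite J in H; [exact H|now apply reach_sym].
Qed.

Lemma spans_refl (X : eset E) e : X e -> spans X e.
Proof. intros H; eapply conn_edge; [exact H|apply joins_ends]. Qed.

(** Each edge of a walk in [X] is replaced by a walk in [Y]; this is the idempotence of the
    closure. *)
Lemma conn_spans (X Y : eset E) u v :
  (forall e, X e -> spans Y e) -> conn X u v -> conn Y u v.
Proof.
  intros S H; induction H as [|v w e H IH Xe J]; [constructor|].
  eapply reach_trans; [exact IH|].
  eapply spans_joins; [apply S, NNPP, Xe|exact J].
Qed.

(** * Walks, paths and finite cycles *)

Definition is_walk (X : eset E) (n : nat) (vs : nat -> V) (es : nat -> E) (u v : V) :=
  vs 0 = u /\ vs n = v /\
  forall i, i < n -> joins ends (es i) (vs i) (vs (S i)) /\ X (es i).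

Lemma conn_walk (X : eset E) (d : E) u v : conn X u v ->
  exists n vs es, is_walk X n vs es u v.
Proof.
  intros H; induction H as [|v w e H IH Xe J].
  (* The trivial walk has no edge; [d] is only a default value for the edge function. *)
  - exists 0, (fun _ => u), (fun _ => d); repeat split; lia.
  - destruct IH as (n & vs & es & H0 & Hn & Hi).
    exists (S n), (fun m => if m <=? n then vs m else w),
      (fun m => if m <? n then es m else e).
    repeat split.
    + exact H0.
    + now rewrite (proj2 (Nat.leb_gt (S n) n)) by lia.
    + rewrite (proj2 (Nat.leb_le i n)) by lia.
      destruct (Nat.ltb_spec i n).
      * rewrite (proj2 (Nat.leb_le (S i) n)) by lia; now apply Hi.
      * rewrite (proj2 (Nat.leb_gt (S i) n)) by lia.
        now replace i with n by lia; rewrite Hn.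
    + destruct (Nat.ltb_spec i n); [now apply Hi|now apply NNPP].
Qed.

(** The closed segment between the positions [i] and [j] is cut out, so later indices shift by
    [j - i]. *)
Lemma walk_shortcut (X : eset E) n vs es u v i j :
  is_walk X n vs es u v -> i < j -> j <= n -> vs i = vs j ->
  exists m vs' es', m < n /\ is_walk X m vs' es' u v.
Proof.
  intros (H0 & Hn & Hi) ij jn eqv.
  exists (n - (j - i)), (fun m => if m <=? i then vs m else vs (m + (j - i))),
    (fun m => if m <? i then es m else es (m + (j - i))).
  split; [lia|]; split; [exact H0|]; split.
  - destruct (Nat.leb_spec (n - (j - i)) i).
    + replace (n - (j - i)) with i by lia.
      now rewrite eqv; replace j with n by lia.
    + now replace (n - (j - i) + (j - i)) with n by lia.
  - intros m mn; destruct (Nat.ltb_spec m i).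
    + rewrite (proj2 (Nat.leb_le m i)), (proj2 (Nat.leb_le (S m) i)) by lia.
      apply Hi; lia.
    + rewrite (proj2 (Nat.leb_gt (S m) i)) by lia.
      destruct (Nat.leb_spec m i).
      * replace m with i by lia; rewrite eqv.
        replace (i + (j - i)) with j by lia.
        replace (S i + (j - i)) with (S j) by lia; apply Hi; lia.
      * replace (S m + (j - i)) with (S (m + (j - i))) by lia; apply Hi; lia.
Qed.

(** Strong induction on the length: a walk that repeats a vertex can be shortened. *)
Lemma conn_path (X : eset E) (d : E) u v : conn X u v ->
  exists n vs es, is_walk X n vs es u v /\
    forall i j, i <= n -> j <= n -> vs i = vs j -> i = j.
Proof.
  intros H; destruct (conn_walk d H) as (n & vs & es & W); clear H.
  revert vs es W; induction n as [n IH] using (well_founded_induction lt_wf).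
  intros vs es W.
  destruct (classic (exists i j, i < j /\ j <= n /\ vs i = vs j))
    as [(i & j & ij & jn & eqv)|N].
  - destruct (walk_shortcut W ij jn eqv) as (m & vs' & es' & mn & W').
    exact (IH m mn vs' es' W').
  - exists n, vs, es; split; [exact W|]; intros i j Hi Hj eqv.
    destruct (Nat.lt_trichotomy i j) as [L|[L|L]]; [|exact L|];
      exfalso; apply N; [exists i, j|exists j, i]; auto.
Qed.

(** A path in [X] between the ends of [e] is closed up by [e], placed at index [n]. If [e] is a
    loop, the path is trivial and the cycle has length 1. *)
Lemma cycle_through (X : eset E) e : ~ X e -> spans X e ->
  exists D, is_finite_cycle_edges ends D /\ D e /\ subset D (fun x => X x \/ x = e).
Proof.
  intros NX H.
  destruct (conn_path e H) as (n & vs & es & (H0 & Hn & Hi) & inj).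
  set (es' := fun i => if i <? n then es i else e).
  exists (fun x => exists i, i < S n /\ es' i = x); split; [|split].
  - exists (S n), vs, es'; split; [lia|]; split; [intros; apply inj; auto; lia|].
    (* Equal edges have the same pair of ends, which distinct vertices on the path allow only for
       equal indices. *)
    assert (es_inj : forall i j, i < j -> j < n -> es i <> es j).
    { intros i j ij jn eqe.
      destruct (Hi i) as [Ji _]; [lia|]; destruct (Hi j) as [Jj _]; [lia|].
      rewrite eqe in Ji; destruct Ji as [Ji|Ji], Jj as [Jj|Jj];
        rewrite Ji in Jj; injection Jj; intros Q1 Q2;
        (apply inj in Q1; [|lia..]); (apply inj in Q2; [|lia..]); lia. }
    split; [|split].
    + intros i j Li Lj; unfold es'.
      destruct (Nat.ltb_spec i n), (Nat.ltb_spec j n); intros eqe; try lia.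
      * destruct (Nat.lt_trichotomy i j) as [L|[L|L]]; auto; exfalso.
        -- now apply (es_inj i j).
        -- now apply (es_inj j i).
      * exfalso; apply NX; rewrite <- eqe; now apply Hi.
      * exfalso; apply NX; rewrite eqe; now apply Hi.
    + intros i Li; unfold es'; destruct (Nat.ltb_spec i n).
      * rewrite Nat.mod_small by lia; now apply Hi.
      * replace i with n by lia; rewrite Nat.Div0.mod_same, H0, Hn.
        apply joins_sym, joins_ends.
    + tauto.
  - exists n; split; [lia|]; unfold es'.
    now rewrite (proj2 (Nat.ltb_ge n n)) by lia.
  - intros x (i & Li & <-); unfold es'; destruct (Nat.ltb_spec i n); [|now right].
    left; now apply Hi.
Qed.

(** Starting behind [e], the other [k - 1] edges lead round the cycle to the other end of [e]. *)
Lemma cycle_spans (D : eset E) e : is_finite_cycle_edges ends D -> D e ->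
  spans (fun x => D x /\ x <> e) e.
Proof.
  intros (k & vs & es & k0 & vinj & einj & J & HD) De.
  destruct (proj1 (HD e) De) as (i0 & Li0 & <-).
  assert (H : forall m, m < k ->
    conn (fun x => D x /\ x <> es i0) (vs (S i0 mod k)) (vs ((S i0 + m) mod k))).
  { induction m as [|m IH]; intros Lm; [rewrite Nat.add_0_r; constructor|].
    eapply reach_trans; [apply IH; lia|].
    assert (Lr : (S i0 + m) mod k < k) by (apply Nat.mod_upper_bound; lia).
    apply conn_edge with (es ((S i0 + m) mod k)).
    - split; [apply HD; eauto|].
      intros Q; apply einj in Q; [|lia..].
      destruct (Nat.lt_ge_cases (S i0 + m) k).
      + rewrite Nat.mod_small in Q; lia.
      (* Here the index has passed [k] once but is below [2k], so the quotient is 1. *)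
      + rewrite (Nat.Div0.mod_eq (S i0 + m) k) in Q.
        replace ((S i0 + m) / k) with 1 in Q; [lia|].
        apply Nat.div_unique with (S i0 + m - k); lia.
    - replace (vs ((S i0 + S m) mod k)) with (vs (S ((S i0 + m) mod k) mod k)).
      + now apply J.
      + f_equal; rewrite <- Nat.add_1_r, Nat.Div0.add_mod_idemp_l; f_equal; lia. }
  specialize (H (k - 1)); replace (S i0 + (k - 1)) with (i0 + 1 * k) in H by lia.
  rewrite Nat.Div0.mod_add, (Nat.mod_small i0 k) in H by lia.
  specialize (H ltac:(lia)); apply reach_sym in H.
  unfold spans; destruct (J i0 Li0) as [Q|Q]; rewrite Q; [exact H|now apply reach_sym].
Qed.

Lemma cycle_finite (D : eset E) : is_finite_cycle_edges ends D -> finite_set D.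
Proof.
  intros (k & vs & es & _ & _ & _ & _ & HD).
  exists (map es (seq 0 k)); intros e De; apply HD in De.
  destruct De as (i & Li & <-); apply in_map, in_seq; lia.
Qed.

Lemma cycle_nonempty (D : eset E) : is_finite_cycle_edges ends D -> exists e, D e.
Proof.
  intros (k & vs & es & k0 & _ & _ & _ & HD).
  exists (es 0); apply HD; eauto.
Qed.

(** * Cuts and bonds *)

(** A walk joining the two sides of a cut uses an edge of it. Together with [cycle_spans] this shows
    that a cycle and a cut never share exactly one edge. *)
Lemma spans_cut (X F : eset E) e :
  is_cut ends F -> F e -> spans X e -> exists x, F x /\ X x.
Proof.
  intros (A & HA) Fe H; apply NNPP; intros N.
  apply HA in Fe; enough (A (fst (ends e)) <-> A (snd (ends e))) by tauto.
  apply (reach_invariant A) in H; [exact H|].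
  intros x Xx; apply NNPP; intros Q; apply N; exists x; split; [|now apply NNPP].
  apply HA; tauto.
Qed.

(* With A the component of one end of e in X and C the component of the other
   end in the graph without the vertices of A, the bond is the cut around C. *)
Lemma bond_through (X : eset E) e : ~ spans X e ->
  exists D, is_bond ends D /\ D e /\ forall x, D x -> ~ X x.
Proof.
  intros NS; set (u := fst (ends e)); set (w := snd (ends e)).
  set (A := conn X u).
  set (C := conn (fun x => ~ A (fst (ends x)) /\ ~ A (snd (ends x))) w).
  assert (Au : A u) by constructor.
  assert (Cw : C w) by constructor.
  assert (Aw : ~ A w) by exact NS.
  assert (CA : forall v, C v -> ~ A v).
  { intros v Cv; refine (proj1 (reach_invariant (fun v => ~ A v) _ Cv) Aw).
    intros x Hx; apply NNPP in Hx; tauto. }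
  assert (stepA : forall x a b, X x -> joins ends x a b -> A a -> A b).
  { intros x a b Xx J Aa; eapply reach_trans; [exact Aa|eapply conn_edge; eauto]. }
  assert (stepC : forall x a b, joins ends x a b -> C a -> ~ C b -> A b).
  { intros x a b J Ca NCb; apply NNPP; intros NAb; apply NCb.
    eapply reach_trans; [exact Ca|eapply conn_edge; [|exact J]]; simpl.
    pose proof (CA a Ca); destruct J as [J|J]; rewrite J; simpl; tauto. }
  set (D := fun x => C (fst (ends x)) /\ ~ C (snd (ends x)) \/
                     ~ C (fst (ends x)) /\ C (snd (ends x))).
  assert (De : D e) by (right; split; [intros Q; exact (CA _ Q Au)|exact Cw]).
  (* By [stepC], an edge leaving the component [C] can only end in [A]. *)
  assert (DA : forall x, D x -> A (fst (ends x)) /\ C (snd (ends x)) \/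
                                C (fst (ends x)) /\ A (snd (ends x))).
  { intros x [[H1 H2]|[H1 H2]]; [right|left]; split; auto.
    - eapply stepC; eauto; apply joins_ends.
    - eapply stepC; eauto; apply joins_sym, joins_ends. }
  exists D; split; [split; [|split]|split].
  - exists C; intros x; unfold D; tauto.
  - eauto.
  (* Minimality: both [A] and [C] are connected without edges of [D], so a side [A'] of a cut inside
     [D] is constant on each. If one edge of [D] crosses that cut, then all do. *)
  - intros F' (A' & HF) (f & Ff) sub.
    assert (const : forall x, ~ D x -> (A' (fst (ends x)) <-> A' (snd (ends x)))).
    { intros x Nx; apply NNPP; intros Q; apply Nx, sub, HF; tauto. }
    assert (constA : forall a, A a -> (A' u <-> A' a)).
    { intros a Aa.
      assert (Q : A a /\ (A' u <-> A' a)); [|tauto].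
      apply (reach_invariant (fun v => A v /\ (A' u <-> A' v)) (u := u) (v := a)
               (F := fun e => ~ X e)); [|exact Aa|tauto].
      intros x Xx; apply NNPP in Xx.
      pose proof (stepA x _ _ Xx (joins_ends x)) as S1.
      pose proof (stepA x _ _ Xx (joins_sym (joins_ends x))) as S2.
      assert (Q : A (fst (ends x)) -> ~ D x).
      { intros A1 Dx; pose proof (S1 A1) as A2.
        destruct (DA x Dx) as [[_ Q]|[Q _]]; exact (CA _ Q ltac:(assumption)). }
      split; intros [Q1 Q2]; [|specialize (S2 Q1)];
        specialize (const x); tauto. }
    assert (constC : forall a, C a -> (A' w <-> A' a)).
    { intros a Ca.
      assert (Q : C a /\ (A' w <-> A' a)); [|tauto].
      refine (proj1 (reach_invariant (fun v => C v /\ (A' w <-> A' v)) _ Ca) _);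
        [|tauto].
      intros x Xx; apply NNPP in Xx.
      assert (Q : ~ D x) by (intros Dx; destruct (DA x Dx); tauto).
      specialize (const x Q); unfold D in Q.
      destruct (classic (C (fst (ends x)))), (classic (C (snd (ends x)))); tauto. }
    assert (crossf : ~ (A' u <-> A' w)).
    { pose proof (DA f (sub f Ff)) as Q; apply HF in Ff.
      destruct Q as [[Q1 Q2]|[Q2 Q1]]; apply constA in Q1; apply constC in Q2; tauto. }
    intros x Dx; apply HF; destruct (DA x Dx) as [[Q1 Q2]|[Q2 Q1]];
      apply constA in Q1; apply constC in Q2; tauto.
  - exact De.
  - intros x Dx Xx; pose proof (stepA x _ _ Xx (joins_ends x)) as S1.
    pose proof (stepA x _ _ Xx (joins_sym (joins_ends x))) as S2.
    destruct (DA x Dx) as [[Q1 Q2]|[Q2 Q1]]; apply CA in Q2; tauto.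
Qed.

(** * The cycle and bond matroids *)

Definition spanning (X : eset E) : Prop := forall e, spans X e.

Lemma FC_span_dep (X : eset E) e : ~ X e -> spans X e ->
  ~ M_FC ends (fun x => X x \/ x = e).
Proof.
  intros NX H I; destruct (cycle_through NX H) as (D & C & _ & sub).
  exact (I D C sub).
Qed.

Lemma FC_remove_not_spans (X : eset E) e :
  M_FC ends X -> X e -> ~ spans (fun x => X x /\ x <> e) e.
Proof.
  intros I Xe H.
  destruct (@cycle_through (fun x => X x /\ x <> e) e) as (D & C & _ & sub);
    [tauto|exact H|].
  apply (I D C); intros x Dx; destruct (sub x Dx) as [[Xx _]| ->]; auto.
Qed.

(** A new cycle would contain [e], and its other edges would connect the ends of [e] in [X]. *)
Lemma FC_add (X : eset E) e : M_FC ends X -> ~ spans X e ->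
  M_FC ends (fun x => X x \/ x = e).
Proof.
  intros I NS D C sub; destruct (classic (D e)) as [De|De].
  - apply NS; eapply conn_mono; [|exact (cycle_spans _ C De)].
    intros x [Dx Nx]; destruct (sub x Dx); tauto.
  - apply (I D C); intros x Dx; destruct (sub x Dx) as [| ->]; tauto.
Qed.

Lemma FC_subset (X Y : eset E) : M_FC ends Y -> subset X Y -> M_FC ends X.
Proof. intros I S D C H; apply (I D C); intros x Dx; auto. Qed.

Lemma FC_base_iff (B : eset E) :
  is_base (M_FC ends) B <-> M_FC ends B /\ spanning B.
Proof.
  split.
  - intros [I mx]; split; [exact I|]; intros e; apply NNPP; intros N.
    apply N, spans_refl, (mx _ (FC_add I N)); [intros x; tauto|now right].
  - intros [I sp]; split; [exact I|]; intros B' I' sub e B'e.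
    apply NNPP; intros NB; apply (FC_span_dep NB (sp e)).
    apply FC_subset with B'; [exact I'|]; intros x [Bx| ->]; auto.
Qed.

(** An edge not spanned by the complement of [X] yields a bond inside [X] by [bond_through];
    conversely, a spanning complement meets every bond by [spans_cut]. *)
Lemma M_B_iff (X : eset E) : M_B ends X <-> spanning (fun e => ~ X e).
Proof.
  split.
  - intros I e; apply NNPP; intros N.
    destruct (bond_through N) as (D & BD & _ & sub).
    apply (I D BD); intros x Dx; now apply NNPP, sub.
  - intros sp D (CD & (e & De) & _) sub.
    destruct (spans_cut CD De (sp e)) as (x & Dx & Nx); auto.
Qed.

(** Walks through [e] take the detour along the rest of the cycle. *)
Lemma spanning_remove_cycle_edge (X D : eset E) e :
  spanning X -> is_finite_cycle_edges ends D -> subset D X -> D e ->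
  spanning (fun x => X x /\ x <> e).
Proof.
  intros sp C sub De f; eapply conn_spans; [|exact (sp f)]; intros x Xx.
  destruct (classic (x = e)) as [->|N]; [|now apply spans_refl].
  eapply conn_mono; [|exact (cycle_spans _ C De)]; intros y [Dy Ny]; auto.
Qed.

Lemma dependent_contains_cycle (X : eset E) : ~ M_FC ends X ->
  exists D, is_finite_cycle_edges ends D /\ subset D X.
Proof.
  intros N; apply NNPP; intros Q; apply N; intros D C S; apply Q; eauto.
Qed.

(** If the complement of a base [X] contained a cycle, one of its edges could be moved to [X].
    Conversely, no edge can leave a forest without its ends losing their connection. *)
Lemma M_B_base_iff (X : eset E) :
  is_base (M_B ends) X <-> is_base (M_FC ends) (fun e => ~ X e).
Proof.
  rewrite FC_base_iff; split.
  - intros [I mx]; apply M_B_iff in I; split; [|exact I].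
    apply NNPP; intros N; destruct (dependent_contains_cycle N) as (D & C & sub).
    destruct (cycle_nonempty C) as (e & De); apply (sub e De).
    apply (mx (fun x => X x \/ x = e)); [|intros x; tauto|now right].
    apply M_B_iff; intros f.
    eapply conn_mono; [|exact (spanning_remove_cycle_edge _ I C sub De f)].
    intros x; simpl; tauto.
  - intros [I sp]; split; [now apply M_B_iff|]; intros X' I' sub e Xe.
    apply M_B_iff in I'; apply NNPP; intros Ne.
    apply (FC_remove_not_spans I Ne).
    eapply conn_mono; [|exact (I' e)]; intros x NX; split; [auto|].
    intros ->; contradiction.
Qed.

(* Kruskal's algorithm along an enumeration f of the edges. *)
Lemma FC_extend (f : E -> nat) (X Y : eset E) :
  (forall x y, f x = f y -> x = y) -> M_FC ends X -> subset X Y ->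
  exists B, subset X B /\ subset B Y /\ M_FC ends B /\ forall e, Y e -> spans B e.
Proof.
  intros finj I sub.
  (* [L e] admits all earlier edges of [Y], not only the selected ones; this spans the same edges
     and makes [B] definable without recursion. *)
  set (L := fun e x => X x \/ Y x /\ f x < f e).
  set (B := fun e => X e \/ Y e /\ ~ spans (L e) e).
  exists B; split; [unfold B; red; tauto|]; split.
  { intros e [Xe|[Ye _]]; auto. }
  split.
  - intros D C DB.
    destruct (classic (subset D X)) as [DX|ND]; [exact (I D C DX)|].
    (* A cycle is finite, so it has a last edge outside [X] in the enumeration. The rest of the
       cycle lies in [L e] and spans that edge, which therefore was not selected. *)
    assert (H : exists e, D e /\ ~ X e /\ forall x, D x -> ~ X x -> f x <= f e).
    { apply NNPP; intros N; destruct (cycle_finite C) as (l & Hl).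
      assert (M : exists m, forall x, D x -> f x <= m).
      { clear - Hl; assert (M : exists m, forall x, In x l -> f x <= m).
        { clear; induction l as [|a l (m & IH)]; [exists 0; simpl; tauto|].
          exists (f a + m); intros x [->|Hx]; [lia|].
          specialize (IH x Hx); lia. }
        destruct M as (m & Hm); exists m; auto. }
      destruct M as (m & Hm).
      assert (G : forall n, exists x, D x /\ ~ X x /\ n <= f x).
      { induction n as [|n (x & Dx & Xx & Hx)].
        - apply NNPP; intros Q; apply ND; intros x Dx; apply NNPP; intros Xx.
          apply Q; exists x; repeat split; auto; lia.
        - apply NNPP; intros Q; apply N; exists x; split; [|split]; auto.
          intros y Dy Xy; apply NNPP; intros Ly; apply Q; exists y.
          repeat split; auto; lia. }
      destruct (G (S m)) as (x & Dx & _ & Hx); specialize (Hm x Dx); lia. }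
    destruct H as (e & De & Xe & mx).
    destruct (DB e De) as [Q|[_ Q]]; [contradiction|apply Q].
    eapply conn_mono; [|exact (cycle_spans _ C De)]; intros x [Dx Nx].
    destruct (classic (X x)) as [Xx|Xx]; [now left|right].
    split; [destruct (DB x Dx) as [|[]]; tauto|].
    specialize (mx x Dx Xx); assert (f x <> f e) by (intros Q2; auto); lia.
  (* Induction along the enumeration: an unselected edge is spanned by [X] and earlier edges of [Y],
     which [B] spans already. *)
  - assert (H : forall n e, f e < n -> Y e -> spans B e).
    { induction n as [|n IH]; [lia|]; intros e Le Ye.
      destruct (classic (B e)) as [Be|Be]; [now apply spans_refl|].
      assert (Q : spans (L e) e) by (apply NNPP; intros Q; apply Be; now right).
      eapply conn_spans; [|exact Q]; intros x [Xx|[Yx Lx]].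
      - apply spans_refl; now left.
      - apply IH; [lia|exact Yx]. }
    intros e; apply (H (S (f e))); lia.
Qed.

Lemma FC_empty : M_FC ends (fun _ => False).
Proof. intros D C sub; destruct (cycle_nonempty C) as (e & De); exact (sub e De). Qed.

Lemma FC_matroid : countable E -> is_matroid (M_FC ends).
Proof.
  intros (f & finj); split; [|split; [|split]].
  - exact FC_empty.
  - exact FC_subset.
  - intros X Y IX NX BY; apply FC_base_iff in BY; destruct BY as [_ sp].
    (* If no edge of [Y] could be added, [X] would span all of [Y], hence every edge, and be a
       base. *)
    apply NNPP; intros N; apply NX, FC_base_iff; split; [exact IX|].
    intros e; eapply conn_spans; [|exact (sp e)]; intros y Yy.
    apply NNPP; intros NS; apply N; exists y; split; [exact Yy|]; split.
    + intros Xy; apply NS, spans_refl, Xy.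
    + exact (FC_add IX NS).
  - intros X Y IX sub.
    destruct (FC_extend f finj IX sub) as (B & XB & BY & IB & sp).
    exists B; split; [exact XB|]; split; [exact IB|]; split; [exact BY|].
    intros B' I' BB B'Y e B'e; apply NNPP; intros NB.
    apply (FC_span_dep NB (sp e (B'Y e B'e))).
    apply FC_subset with B'; [exact I'|]; intros x [Bx| ->]; auto.
Qed.

Lemma B_matroid : countable E -> is_matroid (M_B ends).
Proof.
  intros (f & finj); split; [|split; [|split]].
  - intros D (_ & (e & De) & _) sub; exact (sub e De).
  - intros X Y I S D BD H; apply (I D BD); intros x Dx; auto.
  - intros X Y IX NX BY; apply M_B_iff in IX.
    apply M_B_base_iff, FC_base_iff in BY; destruct BY as [IY _].
    assert (N : ~ M_FC ends (fun e => ~ X e)).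
    { intros I; apply NX, M_B_base_iff, FC_base_iff; now split. }
    destruct (dependent_contains_cycle N) as (D & C & sub).
    (* The complement of the base [Y] is a forest, so the cycle [D] in the complement of [X] meets
       [Y]. Moving the common edge to [X] keeps the complement spanning. *)
    assert (H : exists x, D x /\ Y x).
    { apply NNPP; intros Q; apply (IY D C); intros x Dx Yx; apply Q; eauto. }
    destruct H as (x & Dx & Yx); exists x; split; [exact Yx|].
    split; [exact (sub x Dx)|]; apply M_B_iff; intros e.
    eapply conn_mono; [|exact (spanning_remove_cycle_edge _ IX C sub Dx e)].
    intros y; simpl; tauto.
  - intros X Y IX sub; apply M_B_iff in IX.
    (* A maximal forest [J] outside [Y] is extended to a maximal forest [J'] outside [X]; the
       maximal independent set is [Y] without [J']. *)
    destruct (FC_extend f (X := fun _ => False) (Y := fun e => ~ Y e) finj)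
      as (J & _ & JY & IJ & spJ); [exact FC_empty|intros x []|].
    destruct (FC_extend f (X := J) (Y := fun e => ~ X e) finj)
      as (J' & JJ & JX & IJ' & spJ'); [exact IJ|intros x Jx Xx; exact (JY x Jx (sub x Xx))|].
    exists (fun e => Y e /\ ~ J' e); split.
    { intros x Xx; split; [auto|]; intros Jx; exact (JX x Jx Xx). }
    split; [|split].
    + apply M_B_iff; intros e; apply conn_mono with J'; [intros x; simpl; tauto|].
      eapply conn_spans; [|exact (IX e)]; exact spJ'.
    + intros x; tauto.
    + intros B' IB BB BY e Be; split; [auto|]; intros J'e.
      apply M_B_iff in IB; apply (FC_remove_not_spans IJ' J'e).
      (* An edge outside [B'] lies in [J'] minus [e] if it is in [Y]. Otherwise [J] spans it, and
         [J] avoids [e] because [e] is in [Y]. *)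
      eapply conn_spans; [|exact (IB e)]; intros x NB.
      destruct (classic (Y x)) as [Yx|Yx].
      * apply spans_refl; split; [apply NNPP; intros Q; apply NB, BB; tauto|].
        intros ->; contradiction.
      * eapply conn_mono; [|exact (spJ x Yx)]; intros y Jy; split; [auto|].
        intros ->; exact (JY e Jy (BY e Be)).
Qed.

(** Complementation exchanges the bases of the two matroids, and every forest extends to a base by
    [FC_extend]. *)
Lemma dual_B : countable E -> same_matroid (dual (M_B ends)) (M_FC ends).
Proof.
  intros (f & finj) X; split.
  - intros (B & BB & H); apply M_B_base_iff in BB.
    exact (FC_subset (proj1 BB) H).
  - intros I.
    destruct (FC_extend f (Y := fun _ => True) finj I) as (T & XT & _ & IT & sp).
    { red; tauto. }
    exists (fun e => ~ T e); split; [|intros e Xe NT; auto].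
    apply M_B_base_iff.
    replace (fun e => ~ ~ T e) with T; [apply FC_base_iff; split; red; auto|].
    apply functional_extensionality; intros e.
    apply propositional_extensionality; tauto.
Qed.

(** The fundamental cocircuit of [e]: deleting [e] from the forest separates its ends, and the
    resulting bond avoids the rest of [F]. *)
Lemma FC_fundamental_bond (F : eset E) e : M_FC ends F -> F e ->
  exists D, is_bond ends D /\ D e /\ forall x, D x -> F x -> x = e.
Proof.
  intros I Fe.
  destruct (bond_through (FC_remove_not_spans I Fe)) as (D & BD & De & sub).
  exists D; split; [exact BD|]; split; [exact De|]; intros x Dx Fx.
  apply NNPP; intros N; apply (sub x Dx); auto.
Qed.

End Connectivity.

(** * A circle never meets a finite cut in exactly one edge *)

Local Open Scope R_scope.

(** * Connectedness of the circle minus a point *)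

Lemma S1_eq (x y : S1) : fst (proj1_sig x) = fst (proj1_sig y) ->
  snd (proj1_sig x) = snd (proj1_sig y) -> x = y.
Proof.
  destruct x as [[a b] p], y as [[c d] q]; simpl; intros -> ->.
  now rewrite (proof_irrelevance _ p q).
Qed.

Definition openR (U : R -> Prop) : Prop :=
  forall x, U x -> exists d, 0 < d /\ forall y, Rabs (y - x) < d -> U y.

(** The function with value -1 on [U] and 1 on [W] would be continuous without a zero, against the
    intermediate value theorem. *)
Lemma R_connected (U W : R -> Prop) (a b : R) :
  openR U -> openR W -> (forall x, U x \/ W x) -> (forall x, ~ (U x /\ W x)) ->
  U a -> W b -> False.
Proof.
  intros oU oW cov disj Ua Wb.
  set (h := fun t => if excluded_middle_informative (U t) then -1 else 1).
  assert (hU : forall t, U t -> h t = -1).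
  { intros t Ut; unfold h; destruct excluded_middle_informative; tauto. }
  assert (hW : forall t, W t -> h t = 1).
  { intros t Wt; unfold h; destruct excluded_middle_informative as [Ut|]; auto.
    destruct (disj t); auto. }
  assert (ch : continuity h).
  { intros t eps Heps.
    assert (H : exists d, 0 < d /\ forall y, Rabs (y - t) < d -> h y = h t).
    { destruct (cov t) as [Ut|Wt].
      - destruct (oU t Ut) as (d & Hd & H); exists d; split; [exact Hd|].
        intros y Hy; now rewrite !hU by auto.
      - destruct (oW t Wt) as (d & Hd & H); exists d; split; [exact Hd|].
        intros y Hy; now rewrite !hW by auto. }
    destruct H as (d & Hd & H); exists d; split; [exact Hd|].
    intros y [_ Hy]; simpl in *; unfold Rdist in *; rewrite (H y Hy).
    now replace (h t - h t) with 0 by lra; rewrite Rabs_R0. }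
  assert (hz : forall t, h t <> 0).
  { intros t; destruct (cov t) as [Q|Q]; [rewrite hU|rewrite hW]; auto; lra. }
  destruct (Rle_dec a b) as [L|L].
  - destruct (IVT_cor h a b ch L) as (z & _ & Hz); [|exact (hz z Hz)].
    rewrite hU, hW by auto; lra.
  - destruct (IVT_cor h b a ch ltac:(lra)) as (z & _ & Hz); [|exact (hz z Hz)].
    rewrite (hU a), (hW b) by auto; lra.
Qed.

(** In complex notation the point is -(a + bi)(c + si), where c = (1 - t²)/(1 + t²) and s = 2t/(1 +
    t²) parametrise the unit circle minus -1. The missing value is thus a + bi. *)
Lemma stereo_on_circle (a b t : R) : a ^ 2 + b ^ 2 = 1 ->
  (- (a * ((1 - t * t) / (1 + t * t)) - b * (2 * t / (1 + t * t)))) ^ 2 +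
  (- (a * (2 * t / (1 + t * t)) + b * ((1 - t * t) / (1 + t * t)))) ^ 2 = 1.
Proof.
  intros H; assert (1 + t * t <> 0) by nra.
  transitivity ((a ^ 2 + b ^ 2) * 1); [|rewrite H; ring].
  field; assumption.
Qed.

(* Stereographic coordinates on the circle minus the point p. *)
Definition stereo (p : S1) (t : R) : S1 :=
  exist (fun q => fst q ^ 2 + snd q ^ 2 = 1) (_, _) (stereo_on_circle t (proj2_sig p)).

Lemma stereo_neq (p : S1) (t : R) : stereo p t <> p.
Proof.
  destruct p as [[a b] H]; intros Q; apply (f_equal (@proj1_sig _ _)) in Q.
  cbn [fst snd] in H; simpl in Q; injection Q; clear Q; intros Q2 Q1.
  assert (T : 1 + t * t <> 0) by nra.
  (* Multiplying the equation by the conjugate of a + bi gives c + si = -1, impossible for the real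
     part. *)
  assert (D : (1 - t * t) / (1 + t * t) = -1).
  { set (c := (1 - t * t) / (1 + t * t)) in *; set (s := 2 * t / (1 + t * t)) in *.
    transitivity ((a ^ 2 + b ^ 2) * c); [rewrite H; ring|].
    transitivity (- (a * - (a * c - b * s) + b * - (a * s + b * c))); [ring|].
    rewrite Q1, Q2; lra. }
  apply (f_equal (fun x => x * (1 + t * t))) in D.
  field_simplify in D; [nra|exact T].
Qed.

Lemma stereo_onto (p q : S1) : q <> p -> exists t, stereo p t = q.
Proof.
  destruct p as [[a b] Hp], q as [[c d] Hq]; cbn [fst snd] in Hp, Hq; intros N.
  (* x + iy is -(a - bi)(c + di), the point rotated so that [p] goes to -1; its parameter is then
     y/(1 + x). *)
  set (x := - (a * c + b * d)); set (y := b * c - a * d).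
  assert (H : x ^ 2 + y ^ 2 = 1).
  { unfold x, y; transitivity ((a ^ 2 + b ^ 2) * (c ^ 2 + d ^ 2)); [ring|].
    rewrite Hp, Hq; ring. }
  assert (Nx : 1 + x <> 0).
  (* For x = -1 the two unit vectors have inner product 1 and so coincide. *)
  { intros Q; apply N; apply S1_eq; simpl; unfold x in *.
    - enough ((c - a) * (c - a) = 0) by nra; pose proof (Rle_0_sqr (d - b)).
      unfold Rsqr in *; nra.
    - enough ((d - b) * (d - b) = 0) by nra; pose proof (Rle_0_sqr (c - a)).
      unfold Rsqr in *; nra. }
  exists (y / (1 + x)).
  assert (E0 : 1 + y / (1 + x) * (y / (1 + x)) = 2 / (1 + x)).
  { apply (Rmult_eq_reg_r ((1 + x) ^ 2)); [|apply pow_nonzero, Nx].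
    field_simplify; [nra|exact Nx|exact Nx]. }
  assert (E1 : (1 - y / (1 + x) * (y / (1 + x))) / (1 + y / (1 + x) * (y / (1 + x))) = x).
  { rewrite E0; replace (y / (1 + x) * (y / (1 + x))) with (2 / (1 + x) - 1) by lra.
    field; lra. }
  assert (E2 : 2 * (y / (1 + x)) / (1 + y / (1 + x) * (y / (1 + x))) = y).
  { rewrite E0; field; lra. }
  apply S1_eq; simpl; rewrite E1, E2; unfold x, y.
  - transitivity ((a ^ 2 + b ^ 2) * c); [ring|rewrite Hp; ring].
  - transitivity ((a ^ 2 + b ^ 2) * d); [ring|rewrite Hp; ring].
Qed.

Lemma stereo_open (p : S1) (U : S1 -> Prop) :
  openS1 U -> openR (fun t => U (stereo p t)).
Proof.
  intros oU t Ut; destruct (oU _ Ut) as (eps & Heps & H).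
  destruct p as [[a b] Hp]; simpl in H.
  assert (D : forall t, 1 + t * t <> 0) by (intros; nra).
  assert (C1 : continuity (fun t =>
    - (a * ((1 - t * t) / (1 + t * t)) - b * (2 * t / (1 + t * t))))) by (reg; auto).
  assert (C2 : continuity (fun t =>
    - (a * (2 * t / (1 + t * t)) + b * ((1 - t * t) / (1 + t * t))))) by (reg; auto).
  assert (cont : forall g, continuity g ->
    exists d, 0 < d /\ forall y, Rabs (y - t) < d -> Rabs (g t - g y) < eps).
  { intros g Cg; destruct (Cg t eps Heps) as (d & Hd & Q).
    exists d; split; [exact Hd|]; intros y Hy.
    destruct (Req_dec y t) as [->|N].
    - replace (g t - g t) with 0 by lra; now rewrite Rabs_R0.
    - rewrite Rabs_minus_sym; apply Q; split; [|exact Hy].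
      split; [exact I|auto]. }
  destruct (cont _ C1) as (d1 & H1 & Q1), (cont _ C2) as (d2 & H2 & Q2).
  exists (Rmin d1 d2); split; [now apply Rmin_glb_lt|]; intros y Hy.
  apply H; simpl; [apply Q1|apply Q2];
    (eapply Rlt_le_trans; [exact Hy|]); [apply Rmin_l|apply Rmin_r].
Qed.

Lemma S1_minus_point_connected (p : S1) (U W : S1 -> Prop) (a b : S1) :
  openS1 U -> openS1 W -> (forall x, x <> p -> U x \/ W x) ->
  (forall x, ~ (U x /\ W x)) -> a <> p -> b <> p -> U a -> W b -> False.
Proof.
  intros oU oW cov disj Na Nb Ua Wb.
  destruct (stereo_onto Na) as (s & <-), (stereo_onto Nb) as (t & <-).
  apply (R_connected (U := fun t => U (stereo p t)) (W := fun t => W (stereo p t)) s t);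
    auto using stereo_open, stereo_neq.
Qed.

(** * Rays, and the two sides of a finite cut *)

Section Sides.
Variables (V E : Type) (ends : E -> V * V).

Lemma ray_edge_inj (r : ray V E) m n : is_ray ends r -> snd r m = snd r n -> m = n.
Proof.
  intros [inj J] Q; pose proof (J m) as Jm; pose proof (J n) as Jn; rewrite Q in Jm.
  destruct Jm as [Jm|Jm], Jn as [Jn|Jn]; rewrite Jm in Jn; injection Jn;
    intros Q1 Q2; apply inj in Q1; apply inj in Q2; lia.
Qed.

(** The edges of a ray are distinct, so each member of [F] occurs at most once. *)
Lemma ray_avoids (r : ray V E) (F : list E) : is_ray ends r ->
  exists n, forall m, (n <= m)%nat -> ~ In (snd r m) F.
Proof.
  intros R; induction F as [|e F (n & IH)]; [exists 0%nat; simpl; tauto|].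
  destruct (classic (exists i, snd r i = e)) as [(i & Hi)|N].
  - exists (S (n + i)); intros m Lm [Q|Q]; [|apply (IH m); [lia|exact Q]].
    rewrite <- Hi in Q; apply (ray_edge_inj _ _ R) in Q; lia.
  - exists n; intros m Lm [Q|Q]; [apply N; eauto|exact (IH m Lm Q)].
Qed.

Lemma ray_tail_reach (r : ray V E) (F : E -> Prop) n j : is_ray ends r ->
  (forall m, (n <= m)%nat -> ~ F (snd r m)) ->
  reach ends F (fst r n) (fst r (n + j)%nat).
Proof.
  intros [_ J] H; induction j as [|j IH]; [rewrite Nat.add_0_r; constructor|].
  eapply reach_step; [exact IH|apply (H (n + j)%nat); lia|].
  replace (n + S j)%nat with (S (n + j)) by lia; apply J.
Qed.

Definition ray_shift (n : nat) (r : ray V E) : ray V E :=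
  (fun m => fst r (n + m)%nat, fun m => snd r (n + m)%nat).

Lemma ray_shift_is_ray n r : is_ray ends r -> is_ray ends (ray_shift n r).
Proof.
  intros [inj J]; split; simpl.
  - intros i j Q; apply inj in Q; lia.
  - intros m; rewrite Nat.add_succ_r; apply J.
Qed.

Lemma ray_shift_equiv n r : is_ray ends r -> ray_equiv ends r (ray_shift n r).
Proof.
  intros R F; destruct (ray_avoids F R) as (k & Hk); exists k; simpl; split.
  - intros m Lm; split; apply Hk; lia.
  - rewrite (Nat.add_comm n k); now apply ray_tail_reach with (F := fun e => In e F).
Qed.

(** [A] is one side of the cut [B], and [Z] contains exactly one point on each edge of [B]. Deleting
    [Z] splits the space into the two sides. *)
Variables (A : V -> Prop) (B : eset E) (Z : list (E * R)) (tau : E -> R).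
Hypothesis cutA : forall e, B e <-> (A (fst (ends e)) /\ ~ A (snd (ends e)) \/
                                     ~ A (fst (ends e)) /\ A (snd (ends e))).
Hypothesis HZ : forall e s, In (e, s) Z <-> B e /\ s = tau e.

Lemma cutE_iff e : cutE Z e <-> B e.
Proof.
  split; [intros (s & Hs); now apply HZ in Hs|].
  intros Be; exists (tau e); now apply HZ.
Qed.

Lemma reach_side u v : reach ends (cutE Z) u v -> (A u <-> A v).
Proof.
  intros H; refine (reach_invariant A _ H); intros e; rewrite cutE_iff, cutA; tauto.
Qed.

(** An edge outside [B] has both ends on one side. On an edge of [B] a point cannot be both below
    and above [tau e], so it has only one end as anchor. *)
Lemma anchor_side (q : point ends) u v : anchor Z q u -> anchor Z q v -> (A u <-> A v).
Proof.
  destruct q as [w|e t|w]; simpl; [intros -> ->; tauto| |tauto].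
  assert (Q : (forall s, In (e, s) Z -> t < s) -> (forall s, In (e, s) Z -> s < t) ->
              (A (fst (ends e)) <-> A (snd (ends e)))).
  { intros H1 H2; destruct (classic (B e)) as [Be|Be]; [|specialize (cutA e); tauto].
    assert (Hz : In (e, tau e) Z) by now apply HZ.
    specialize (H1 _ Hz); specialize (H2 _ Hz); lra. }
  intros [[<- H1]|[<- H1]] [[<- H2]|[<- H2]]; tauto.
Qed.

Lemma samecomp_side (q : point ends) v u :
  samecomp Z (PV ends v) q -> anchor Z q u -> (A v <-> A u).
Proof.
  intros (_ & _ & [(v' & u' & Hv & Hu & H)|(e & s & t & Q & _)]) Ha; [|discriminate].
  simpl in Hv; subst v'; apply reach_side in H; rewrite H; now apply anchor_side with q.
Qed.

(** As a union of basic open sets this is open at once; disjointness and covering remain to be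
    shown. *)
Definition side (P : V -> Prop) (p : point ends) : Prop :=
  exists v, P v /\ basic Z (PV ends v) p.

Lemma side_open P : validZ Z -> openH (side P).
Proof.
  intros vZ p (v & Pv & H); exists Z, (PV ends v).
  split; [exact vZ|]; split; [exact I|]; split; [exact H|]; intros q Hq; exists v; auto.
Qed.

Lemma samecomp_anchored (q : point ends) v :
  samecomp Z (PV ends v) q -> exists u, anchor Z q u.
Proof.
  intros (_ & _ & [(v' & u' & _ & Hu & _)|(e & s & t & Q & _)]); [eauto|discriminate].
Qed.

Lemma side_disjoint p : ~ (side A p /\ side (fun v => ~ A v) p).
Proof.
  intros [(v & Av & Hv) (w & Aw & Hw)].
  assert (N : forall q, samecomp Z (PV ends v) q -> samecomp Z (PV ends w) q -> False).
  { intros q H1 H2; destruct (samecomp_anchored H1) as (u & Hu).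
    pose proof (samecomp_side _ H1 Hu); pose proof (samecomp_side _ H2 Hu); tauto. }
  destruct p as [x|e t|[S (r0 & R0 & HS)]]; [eapply N; eauto..|].
  simpl in Hv, Hw; destruct Hv as (r & Sr & [Hr _]), Hw as (r' & Sr' & [Hr' _]).
  apply HS in Sr; apply HS in Sr'.
  (* A tail of [r0] avoids [Z] and is connected off [Z] to any equivalent ray, so two rays of one
     end cannot lie on different sides. *)
  assert (side_r0 : forall r, ray_equiv ends r0 r ->
     exists n0, forall n, (n0 <= n)%nat -> exists m, (A (fst r0 n) <-> A (fst r m))).
  { intros r1 Eq; destruct (Eq (map fst Z)) as (n & Hn & Rn).
    exists n; intros m Lm; exists n.
    assert (F : forall e, cutE Z e -> In e (map fst Z)).
    { intros e (s & Hs); now apply (in_map fst) in Hs. }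
    replace m with (n + (m - n))%nat by lia.
    rewrite <- (reach_side (reach_mono _ F Rn)).
    symmetry; apply reach_side, reach_mono with (F := fun e => In e (map fst Z));
      [exact F|].
    apply ray_tail_reach; [exact R0|]; intros k Lk; apply (Hn k Lk). }
  destruct (side_r0 r) as (n1 & H1); [tauto|].
  destruct (side_r0 r') as (n2 & H2); [tauto|].
  destruct (H1 (n1 + n2)%nat ltac:(lia)) as (m1 & Q1).
  destruct (H2 (n1 + n2)%nat ltac:(lia)) as (m2 & Q2).
  pose proof (samecomp_side _ (Hr m1) (eq_refl : anchor Z (PV ends _) _)).
  pose proof (samecomp_side _ (Hr' m2) (eq_refl : anchor Z (PV ends _) _)).
  tauto.
Qed.

Lemma side_cover p : valid p -> (forall e s, In (e, s) Z -> p <> PE ends e s) ->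
  side A p \/ side (fun v => ~ A v) p.
Proof.
  intros vp Np; enough (H : exists v, basic Z (PV ends v) p).
  { destruct H as (v & Hv); destruct (classic (A v)); [left|right]; exists v; auto. }
  destruct p as [v|e t|[S (r & R & HS)]].
  - exists v; split; [exact I|]; split; [exact I|]; left; exists v, v.
    repeat split; constructor.
  - assert (H : exists v, anchor Z (PE ends e t) v).
    { destruct (classic (B e)) as [Be|Be].
      - assert (Hz : In (e, tau e) Z) by now apply HZ.
        destruct (Rtotal_order t (tau e)) as [L|[L|L]].
        + exists (fst (ends e)); left; split; auto; intros s Hs.
          apply HZ in Hs; destruct Hs as [_ ->]; exact L.
        + subst t; destruct (Np _ _ Hz); reflexivity.
        + exists (snd (ends e)); right; split; auto; intros s Hs.
          apply HZ in Hs; destruct Hs as [_ ->]; exact L.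
      - exists (fst (ends e)); left; split; auto; intros s Hs; apply HZ in Hs; tauto. }
    destruct H as (v & Hv); exists v; split; [exact I|]; split.
    + split; [exact vp|]; intros Hz; exact (Np _ _ Hz eq_refl).
    + left; exists v, v; split; [reflexivity|]; split; [exact Hv|constructor].
  (* A tail of the ray misses all cut edges, hence lies in one component and represents the same
     end. *)
  - destruct (ray_avoids (map fst Z) R) as (n & Hn).
    assert (H : forall m, (n <= m)%nat -> ~ cutE Z (snd r m)).
    { intros m Lm (s & Hs); apply (Hn m Lm); now apply (in_map fst) in Hs. }
    assert (T : forall j, reach ends (cutE Z) (fst r n) (fst r (n + j)%nat)).
    { intros j; now apply ray_tail_reach. }
    exists (fst r n); simpl; exists (ray_shift n r); split; [|split].
    + apply HS; split; [now apply ray_shift_is_ray|now apply ray_shift_equiv].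
    + intros j; split; [exact I|]; split; [exact I|]; left.
      exists (fst r n), (fst r (n + j)%nat); repeat split; apply T.
    + intros j t Ht; pose proof (H (n + j)%nat ltac:(lia)) as Nc; simpl.
      split; [exact I|]; split.
      * split; [exact Ht|]; intros Q; apply Nc; exists t; exact Q.
      * left; exists (fst r n), (fst (ends (snd r (n + j)%nat))).
        split; [reflexivity|]; split.
        -- left; split; [reflexivity|]; intros s Hs; destruct Nc; exists s; exact Hs.
        -- destruct (proj2 R (n + j)%nat) as [Q|Q]; rewrite Q; simpl; [apply T|].
           rewrite <- Nat.add_succ_r; apply T.
Qed.
End Sides.

(** If [e0] were the only common edge, one point on each cut edge could be chosen so that the circle
    meets only the one on [e0]. The circle minus that point would be covered by the two disjoint
    open sides and meet both. *)
Lemma circle_finite_cut (V E : Type) (ends : E -> V * V) (F B : eset E) (e0 : E) :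
  is_circle_edges ends F -> is_cut ends B -> finite_set B -> F e0 -> B e0 ->
  exists e, F e /\ B e /\ e <> e0.
Proof.
  intros (S & (f & vf & finj & fcont & _ & HS) & HF) (A & HA) (l & Hl) Fe0 Be0.
  apply NNPP; intros N.
  (* On a cut edge other than [e0] the parameter [t] is that of a point missed by the circle; on
     [e0] it is the midpoint. *)
  assert (H : forall e, exists t, 0 < t < 1 /\ (e = e0 -> t = / 2) /\
                                  (B e -> e <> e0 -> ~ S (PE ends e t))).
  { intros e; destruct (classic (B e /\ e <> e0)) as [[Be Ne]|Q].
    - assert (Q : ~ F e) by (intros Fe; apply N; eauto).
      rewrite HF in Q; apply not_all_ex_not in Q; destruct Q as (t & Q).
      apply imply_to_and in Q; exists t; tauto.
    - exists (/ 2); split; [lra|]; tauto. }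
  set (tau := fun e => proj1_sig (constructive_indefinite_description _ (H e))).
  assert (Htau : forall e, 0 < tau e < 1 /\ (e = e0 -> tau e = / 2) /\
                           (B e -> e <> e0 -> ~ S (PE ends e (tau e)))).
  { intros e; exact (proj2_sig (constructive_indefinite_description _ (H e))). }
  set (Z := map (fun e => (e, tau e))
    (filter (fun e => if excluded_middle_informative (B e) then true else false) l)).
  assert (HZ : forall e s, In (e, s) Z <-> B e /\ s = tau e).
  { intros e s; unfold Z; rewrite in_map_iff; split.
    - intros (x & Q & Hx); injection Q; intros <- <-; apply filter_In in Hx.
      destruct excluded_middle_informative; [auto|destruct Hx; discriminate].
    - intros [Be ->]; exists e; split; [reflexivity|]; apply filter_In.
      split; [auto|]; destruct excluded_middle_informative; tauto. }
  assert (vZ : validZ Z).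
  { intros [e s] Hs; apply HZ in Hs; destruct Hs as [_ ->]; apply Htau. }
  assert (Hpt : forall t, 0 < t < 1 -> exists x, f x = PE ends e0 t).
  { intros t Ht; apply HS; now apply HF. }
  destruct (Hpt (/ 2) ltac:(lra)) as (p & Hp).
  (* The quarter points of [e0] lie on either side of the removed midpoint, hence on different sides
     of the cut. *)
  destruct (Hpt (/ 4) ltac:(lra)) as (a & Ha).
  destruct (Hpt (3 / 4) ltac:(lra)) as (b & Hb).
  assert (tau0 : tau e0 = / 2) by now apply Htau.
  assert (Nap : a <> p).
  { intros ->; rewrite Ha in Hp; injection Hp; intros; lra. }
  assert (Nbp : b <> p).
  { intros ->; rewrite Hb in Hp; injection Hp; intros; lra. }
  assert (cov : forall x, x <> p ->
            side Z A (f x) \/ side Z (fun v => ~ A v) (f x)).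
  { intros x Nx; apply (side_cover A _ _ _ HZ); [apply vf|].
    intros e s Hs Q; apply HZ in Hs; destruct Hs as [Be ->].
    destruct (classic (e = e0)) as [->|Ne].
    - apply Nx, finj; rewrite Q, Hp, tau0; reflexivity.
    - apply (proj2 (proj2 (Htau e)) Be Ne), HS; eauto. }
  assert (disj : forall x, ~ (side Z A (f x) /\ side Z (fun v => ~ A v) (f x))).
  { intros x; exact (side_disjoint _ _ HA HZ (p := f x)). }
  assert (oA : forall P, openS1 (fun x => side Z P (f x))).
  { intros P; apply fcont, side_open, vZ. }
  assert (Sa : forall v, basic Z (PV ends v) (f a) -> (A v <-> A (fst (ends e0)))).
  { intros v Q; rewrite Ha in Q; apply (samecomp_side A _ _ HA HZ _ Q).
    left; split; [reflexivity|]; intros s Hs; apply HZ in Hs; lra. }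
  assert (Sb : forall v, basic Z (PV ends v) (f b) -> (A v <-> A (snd (ends e0)))).
  { intros v Q; rewrite Hb in Q; apply (samecomp_side A _ _ HA HZ _ Q).
    right; split; [reflexivity|]; intros s Hs; apply HZ in Hs; lra. }
  apply HA in Be0.
  destruct (cov a Nap) as [Qa|Qa], (cov b Nbp) as [Qb|Qb].
  - destruct Qa as (v & Av & Qa), Qb as (w & Aw & Qb); apply Sa in Qa; apply Sb in Qb.
    tauto.
  - exact (S1_minus_point_connected (oA A) (oA _) cov disj Nap Nbp Qa Qb).
  - exact (S1_minus_point_connected (oA A) (oA _) cov disj Nbp Nap Qb Qa).
  - destruct Qa as (v & Av & Qa), Qb as (w & Aw & Qb); apply Sa in Qa; apply Sb in Qb.
    tauto.
Qed.

(** * Polygonal coordinates on the unit circle *)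

Definition close (eps : R) (x y : S1) : Prop :=
  Rabs (fst (proj1_sig x) - fst (proj1_sig y)) < eps /\
  Rabs (snd (proj1_sig x) - snd (proj1_sig y)) < eps.

(* A substitute for the angle, with values in [0, 4), that avoids trigonometry. *)
Definition ang (x : S1) : R :=
  if Rle_dec 0 (snd (proj1_sig x)) then 1 - fst (proj1_sig x)
  else 3 + fst (proj1_sig x).

Lemma ang_range x : 0 <= ang x < 4.
Proof.
  destruct x as [[a b] H]; unfold ang; cbn [fst snd proj1_sig] in *.
  destruct Rle_dec; nra.
Qed.

Lemma ang_onto a : 0 <= a < 4 -> exists x, ang x = a.
Proof.
  intros Ha; destruct (Rle_dec a 2) as [L|L].
  - assert (H : (1 - a) ^ 2 + sqrt (1 - (1 - a) ^ 2) ^ 2 = 1).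
    { rewrite pow2_sqrt; nra. }
    exists (exist (fun q => fst q ^ 2 + snd q ^ 2 = 1) (1 - a, sqrt (1 - (1 - a) ^ 2)) H).
    unfold ang; cbn [fst snd proj1_sig]; destruct Rle_dec as [|N]; [lra|].
    destruct N; apply sqrt_pos.
  - assert (H : (a - 3) ^ 2 + (- sqrt (1 - (a - 3) ^ 2)) ^ 2 = 1).
    { replace ((- sqrt (1 - (a - 3) ^ 2)) ^ 2) with (sqrt (1 - (a - 3) ^ 2) ^ 2) by ring.
      rewrite pow2_sqrt; nra. }
    exists (exist (fun q => fst q ^ 2 + snd q ^ 2 = 1) (a - 3, - sqrt (1 - (a - 3) ^ 2)) H).
    unfold ang; cbn [fst snd proj1_sig]; destruct Rle_dec as [Q|]; [|lra].
    assert (0 < sqrt (1 - (a - 3) ^ 2)) by (apply sqrt_lt_R0; nra); lra.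
Qed.

(* Closeness modulo m of two reals in [0, m). *)
Definition circ_close (m d a b : R) : Prop := Rabs (b - a) < d \/ m - d < Rabs (b - a).

Lemma ang_continuous x eps : 0 < eps ->
  exists d, 0 < d /\ forall y, close d x y -> circ_close 4 eps (ang x) (ang y).
Proof.
  intros He; destruct x as [[a b] H]; unfold ang, close, circ_close.
  cbn [fst snd proj1_sig] in *.
  (* The two formulas for [ang] meet at (1, 0) and (-1, 0). At (1, 0) the values jump between 0 and
     4, which the second case of [circ_close] absorbs. *)
  destruct (Req_dec b 0) as [->|Nb].
  - exists (Rmin eps 1 / 2); split; [unfold Rmin; destruct Rle_dec; lra|].
    intros [[c d] K]; cbn [fst snd proj1_sig] in *.
    assert (Q : a = 1 \/ a = -1).
    { assert (Q : (a - 1) * (a + 1) = 0) by nra.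
      apply Rmult_integral in Q; destruct Q; [left|right]; lra. }
    unfold Rmin; destruct (Rle_dec eps 1); intros [H1 H2];
      apply Rabs_def2 in H1; apply Rabs_def2 in H2;
      destruct Q as [-> | ->]; destruct (Rle_dec 0 0), (Rle_dec 0 d);
      unfold Rabs; destruct Rcase_abs; try (left; lra); try (right; lra); lra.
  (* The bound |b| keeps the nearby point in the same half of the circle. *)
  - exists (Rmin eps (Rabs b)); split.
    + apply Rmin_glb_lt; [exact He|now apply Rabs_pos_lt].
    + intros [[c d] K] [H1 H2]; cbn [fst snd proj1_sig] in *; left.
      assert (L1 := Rmin_l eps (Rabs b)); assert (L2 := Rmin_r eps (Rabs b)).
      set (m := Rmin eps (Rabs b)) in *.
      assert (Q1 : Rabs (a - c) < eps) by lra.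
      assert (Q2 : Rabs (b - d) < Rabs b) by lra.
      apply Rabs_def2 in Q1; revert Q2; unfold Rabs at 1 2.
      destruct (Rcase_abs (b - d)), (Rcase_abs b); intros Q2;
        destruct (Rle_dec 0 b), (Rle_dec 0 d); try lra; apply Rabs_def1; lra.
Qed.

Lemma ang_inv_continuous x eps : 0 < eps ->
  exists d, 0 < d /\ forall y, circ_close 4 d (ang x) (ang y) -> close eps x y.
Proof.
  intros He.
  (* The first coordinate is |ang - 2| - 1, which is 1-Lipschitz and agrees at 0 and 4. *)
  assert (Hfst : forall y d, d <= 1 -> circ_close 4 d (ang x) (ang y) ->
            Rabs (fst (proj1_sig x) - fst (proj1_sig y)) < d).
  { intros y d Hd; pose proof (ang_range x) as Rx; pose proof (ang_range y) as Ry.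
    assert (fe : forall z, fst (proj1_sig z) = Rabs (ang z - 2) - 1).
    { intros [[c e] K]; unfold ang; cbn [fst snd proj1_sig] in *.
      destruct Rle_dec; unfold Rabs; destruct Rcase_abs; nra. }
    rewrite !fe; intros [Q|Q]; revert Q; unfold Rabs; repeat destruct Rcase_abs; lra. }
  destruct (classic (snd (proj1_sig x) = 0)) as [b0|Nb].
  (* For b = 0 the second coordinate satisfies d² = a² - c² ≤ 2|a - c|, whence the bound eps²/2. *)
  - exists (Rmin (Rmin eps 1) (eps * eps / 2)).
    assert (0 < eps * eps / 2) by nra.
    split; [repeat apply Rmin_glb_lt; lra|].
    intros y Hy; apply Hfst in Hy; [|eapply Rle_trans; [apply Rmin_l|apply Rmin_r]].
    assert (L1 : Rabs (fst (proj1_sig x) - fst (proj1_sig y)) < eps).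
    { eapply Rlt_le_trans; [exact Hy|eapply Rle_trans; apply Rmin_l]. }
    split; [exact L1|].
    assert (L2 : Rabs (fst (proj1_sig x) - fst (proj1_sig y)) < eps * eps / 2).
    { eapply Rlt_le_trans; [exact Hy|apply Rmin_r]. }
    clear Hy L1 Hfst; destruct x as [[a b] H1], y as [[c d] H2].
    cbn [fst snd proj1_sig] in *; subst b.
    assert (Hd : d * d < eps * eps).
    { apply Rabs_def2 in L2.
      assert (-1 <= a <= 1) by nra; assert (-1 <= c <= 1) by nra.
      replace (d * d) with ((a - c) * (a + c)) by nra.
      destruct (Rle_dec 0 (a - c)).
      - assert (0 <= (a - c) * (2 - (a + c))) by (apply Rmult_le_pos; lra); lra.
      - assert (0 <= (c - a) * (2 + (a + c))) by (apply Rmult_le_pos; lra); lra. }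
    apply Rabs_def1; nra.
  - set (a0 := ang x) in *.
    assert (Ha0 : 0 < a0 < 2 /\ 0 < snd (proj1_sig x) \/
                  2 < a0 < 4 /\ snd (proj1_sig x) < 0).
    { unfold a0, ang; destruct x as [[a b] H1]; cbn [fst snd proj1_sig] in *.
      pose proof (Rsqr_pos_lt b Nb) as Hb; unfold Rsqr in Hb.
      assert (-1 < a < 1) by (split; nra).
      destruct (Rdichotomy b 0 Nb), Rle_dec; lra. }
    set (b0 := Rabs (snd (proj1_sig x))).
    assert (Hb0 : 0 < b0) by now apply Rabs_pos_lt.
    (* The distance of [a0] to 0, 2 and 4, the values at which the half of the circle changes. *)
    set (gap := Rmin (Rmin a0 (4 - a0)) (Rabs (a0 - 2))).
    assert (Hgap : 0 < gap).
    { repeat apply Rmin_glb_lt; [lra|lra|apply Rabs_pos_lt; lra]. }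
    (* The last bound comes from |b - d| |b + d| ≤ 2|a - c| and |b + d| ≥ |b|, valid since b and d
       do not have opposite signs. *)
    exists (Rmin (Rmin (Rmin eps 1) gap) (eps * b0 / 2)).
    assert (0 < eps * b0 / 2) by nra.
    split; [apply Rmin_glb_lt; [apply Rmin_glb_lt; [apply Rmin_glb_lt|]|]; lra|].
    intros y Hy.
    assert (Ld : forall z, z < Rmin (Rmin (Rmin eps 1) gap) (eps * b0 / 2) ->
              z < eps /\ z < gap /\ z < eps * b0 / 2).
    { intros z; unfold Rmin; repeat destruct Rle_dec; lra. }
    assert (Ld' : Rmin (Rmin (Rmin eps 1) gap) (eps * b0 / 2) <= 1 /\
                  Rmin (Rmin (Rmin eps 1) gap) (eps * b0 / 2) <= gap).
    { unfold Rmin; repeat destruct Rle_dec; lra. }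
    destruct Ld' as [Ld1 Ldg].
    pose proof (Hfst y _ Ld1 Hy) as Hx; apply Ld in Hx; destruct Hx as (X1 & _ & X3).
    split; [exact X1|].
    assert (sgn : 0 < snd (proj1_sig x) /\ 0 <= snd (proj1_sig y) \/
                  snd (proj1_sig x) < 0 /\ snd (proj1_sig y) <= 0).
    { assert (Gy : Rabs (ang y - a0) < gap \/ 4 - gap < Rabs (ang y - a0)).
      { destruct Hy as [Hy|Hy]; [left|right]; lra. }
      pose proof (ang_range y) as Ry.
      assert (G : gap <= a0 /\ gap <= 4 - a0 /\ gap <= Rabs (a0 - 2)).
      { unfold gap, Rmin; repeat destruct Rle_dec; lra. }
      destruct G as (G1 & G2 & G3).
      assert (sy : ang y < 2 /\ 0 <= snd (proj1_sig y) \/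
                   2 <= ang y /\ snd (proj1_sig y) <= 0).
      { clear; unfold ang; destruct y as [[c d] K]; cbn [fst snd proj1_sig] in *.
        destruct Rle_dec; [|right; split; nra].
        destruct (Rlt_dec (1 - c) 2); [left; lra|right; split; nra]. }
      destruct Gy as [Gy|Gy].
      - revert Gy G3; unfold Rabs; destruct (Rcase_abs (ang y - a0)), (Rcase_abs (a0 - 2));
          intros Gy G3; lra.
      - revert Gy; unfold Rabs; destruct (Rcase_abs (ang y - a0)); intros Gy; lra. }
    unfold b0 in *; clear - H sgn X3 He Hb0; destruct x as [[a b] H1], y as [[c d] H2].
    cbn [fst snd proj1_sig] in *.
    assert (-1 <= a <= 1) by nra; assert (-1 <= c <= 1) by nra.
    assert (Q : Rabs (b - d) * Rabs (b + d) <= Rabs (a - c) * 2).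
    { rewrite <- Rabs_mult.
      replace ((b - d) * (b + d)) with ((a - c) * - (a + c)) by nra.
      rewrite Rabs_mult; apply Rmult_le_compat_l; [apply Rabs_pos|].
      unfold Rabs; destruct Rcase_abs; lra. }
    assert (Q2 : Rabs b <= Rabs (b + d)).
    { unfold Rabs; destruct (Rcase_abs b), (Rcase_abs (b + d)); lra. }
    apply Rnot_le_lt; intros N.
    assert (eps * Rabs b <= Rabs (b - d) * Rabs (b + d))
      by (apply Rmult_le_compat; lra).
    lra.
Qed.

(* The point (i, t) lies at parameter t on the i-th side of a polygon with k sides. *)
Definition coord (k : nat) (c : nat * R) : Prop := (fst c < k)%nat /\ 0 <= snd c < 1.

(** The second case serves a corner [(i, 0)], which is also approached along the end of the
    preceding side. *)
Definition near (k : nat) (eps : R) (c0 c : nat * R) : Prop :=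
  fst c = fst c0 /\ Rabs (snd c - snd c0) < eps \/
  snd c0 = 0 /\ (S (fst c) mod k)%nat = fst c0 /\ 1 - eps < snd c.

(** The position along the perimeter, with values in [0, k). *)
Definition theta (c : nat * R) : R := INR (fst c) + snd c.

Lemma INR_lt_plus1 i j : INR i < INR j + 1 -> (i <= j)%nat.
Proof. rewrite <- S_INR; intros H; apply INR_lt in H; lia. Qed.

Lemma theta_range k c : coord k c -> 0 <= theta c < INR k.
Proof.
  intros [H1 H2]; unfold theta; pose proof (pos_INR (fst c)).
  apply le_INR in H1; rewrite S_INR in H1; lra.
Qed.

Lemma theta_inj k c c' : coord k c -> coord k c' -> theta c = theta c' -> c = c'.
Proof.
  destruct c as [i t], c' as [j s]; unfold coord, theta; simpl; intros [_ H] [_ H'] Q.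
  assert (i = j) as -> by (apply Nat.le_antisymm; apply INR_lt_plus1; lra).
  f_equal; lra.
Qed.

Lemma theta_onto k a : 0 <= a < INR k -> exists c, coord k c /\ theta c = a.
Proof.
  induction k as [|k IH]; [simpl; lra|]; rewrite S_INR; intros Ha.
  destruct (Rlt_dec a (INR k)) as [L|L].
  - destruct IH as (c & [H1 H2] & Hc); [lra|].
    exists c; split; [split; [lia|exact H2]|exact Hc].
  - exists (k, a - INR k); unfold coord, theta; simpl; split; [split; [lia|lra]|lra].
Qed.

Lemma circ_close_of_near k eps c0 c : coord k c0 -> coord k c -> near k eps c0 c ->
  circ_close (INR k) eps (theta c0) (theta c).
Proof.
  destruct c0 as [i0 t0], c as [i t]; unfold coord, near, theta, circ_close; simpl.
  intros [Li0 T0] [Li T] [[-> H]|(-> & Q & H)].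
  - left; now replace (INR i0 + t - (INR i0 + t0)) with (t - t0) by lra.
  - destruct (Nat.eq_dec (S i) k) as [<-|N].
    + rewrite Nat.Div0.mod_same in Q; subst i0; right; rewrite S_INR; simpl.
      eapply Rlt_le_trans; [|apply Rle_abs]; lra.
    + rewrite Nat.mod_small in Q by lia; subst i0; left; rewrite S_INR.
      apply Rabs_def1; lra.
Qed.

Lemma near_of_circ_close k eps c0 : coord k c0 -> 0 < eps ->
  exists d, 0 < d /\ forall c, coord k c ->
    circ_close (INR k) d (theta c0) (theta c) -> near k eps c0 c.
Proof.
  intros C0 He; pose proof (theta_range C0) as R0.
  destruct c0 as [i0 t0]; destruct C0 as [Li0 T0]; unfold theta, circ_close in *.
  cbn [fst snd] in *.
  assert (Ki0 : INR i0 + 1 <= INR k) by (rewrite <- S_INR; now apply le_INR).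
  pose proof (pos_INR i0) as Pi0.
  assert (sq : forall i j t, 0 <= t < 1 -> INR j <= INR i + t < INR j + 1 -> i = j).
  { intros i j t Ht H; apply Nat.le_antisymm; apply INR_lt_plus1; lra. }
  destruct (Req_dec t0 0) as [->|N].
  - exists (Rmin eps 1); split; [apply Rmin_glb_lt; lra|].
    intros [i t] Cc; pose proof (theta_range Cc) as Rc; destruct Cc as [Li T].
    unfold theta in Rc; cbn [fst snd] in *.
    assert (L1 := Rmin_l eps 1); assert (L2 := Rmin_r eps 1); set (d := Rmin eps 1) in *.
    intros [Q|Q].
    + apply Rabs_def2 in Q; destruct (Rle_dec (INR i0) (INR i + t)) as [L|L].
      * left; cbn [fst snd]; assert (i = i0) as -> by (apply (sq _ _ t); lra).
        split; [reflexivity|apply Rabs_def1; lra].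
      * right; cbn [fst snd]; split; [reflexivity|].
        destruct i0 as [|j]; [simpl in *; pose proof (pos_INR i); lra|].
        rewrite S_INR in *; assert (i = j) as -> by (apply (sq _ _ t); lra).
        split; [apply Nat.mod_small; lia|lra].
    (* The distance wraps around only for the corner 0 approached from the last side. *)
    + right; cbn [fst snd]; split; [reflexivity|].
      destruct k as [|k]; [lia|]; rewrite S_INR in *.
      revert Q; unfold Rabs; destruct Rcase_abs; intros Q; [lra|].
      assert (i0 = 0%nat) as ->.
      { apply Nat.le_0_r, INR_lt_plus1; simpl; lra. }
      simpl (INR 0) in *.
      assert (i = k) as -> by (apply (sq _ _ t); lra).
      split; [apply Nat.Div0.mod_same|lra].
  (* This bound confines the neighbourhood to the interior of the side [i0]. *)
  - exists (Rmin (Rmin eps t0) (1 - t0)).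
    split; [repeat apply Rmin_glb_lt; lra|].
    intros [i t] Cc; pose proof (theta_range Cc) as Rc; destruct Cc as [Li T].
    unfold theta in Rc; cbn [fst snd] in *.
    assert (L1 := Rmin_l (Rmin eps t0) (1 - t0)); assert (L2 := Rmin_r (Rmin eps t0) (1 - t0)).
    assert (L3 := Rmin_l eps t0); assert (L4 := Rmin_r eps t0).
    set (d := Rmin (Rmin eps t0) (1 - t0)) in *.
    intros [Q|Q].
    + apply Rabs_def2 in Q; left; cbn [fst snd].
      assert (i = i0) as -> by (apply (sq _ _ t); lra).
      split; [reflexivity|apply Rabs_def1; lra].
    + exfalso; revert Q; unfold Rabs; destruct Rcase_abs; lra.
Qed.

(** Scaling [ang] by k/4 and inverting [theta] identifies the circle with a polygon with [k] sides,
    continuously in both directions. Injectivity of [g] follows from the last clause. *)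
Lemma S1_polygon (k : nat) : (0 < k)%nat -> exists g : S1 -> nat * R,
  (forall x, coord k (g x)) /\
  (forall c, coord k c -> exists x, g x = c) /\
  (forall x eps, 0 < eps -> exists d, 0 < d /\
     forall y, close d x y -> near k eps (g x) (g y)) /\
  (forall x eps, 0 < eps -> exists d, 0 < d /\
     forall y, near k d (g x) (g y) -> close eps x y).
Proof.
  intros k0; assert (Kp : 0 < INR k) by now apply lt_0_INR.
  assert (H : forall x, exists c, coord k c /\ theta c = ang x * (INR k / 4)).
  { intros x; apply theta_onto; pose proof (ang_range x); split; nra. }
  set (g := fun x => proj1_sig (constructive_indefinite_description _ (H x))).
  assert (Hg : forall x, coord k (g x) /\ theta (g x) = ang x * (INR k / 4)).
  { intros x; exact (proj2_sig (constructive_indefinite_description _ (H x))). }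
  assert (scale : forall x y d, circ_close (INR k) (d * (INR k / 4)) (theta (g x)) (theta (g y))
                  <-> circ_close 4 d (ang x) (ang y)).
  { intros x y d; rewrite !(proj2 (Hg _)); unfold circ_close.
    replace (ang y * (INR k / 4) - ang x * (INR k / 4))
      with ((ang y - ang x) * (INR k / 4)) by ring.
    rewrite Rabs_mult, (Rabs_right (INR k / 4)) by lra.
    set (r := Rabs (ang y - ang x)).
    split; (intros [Q|Q]; [left|right]); nra. }
  exists g; split; [|split; [|split]].
  - intros x; apply Hg.
  - intros c Hc; pose proof (theta_range Hc) as Rc.
    destruct (@ang_onto (theta c * (4 / INR k))) as (x & Hx).
    { split.
      - apply Rmult_le_pos; [lra|apply Rlt_le, Rdiv_lt_0_compat; lra].
      - replace 4 with (INR k * (4 / INR k)) at 2 by (field; lra).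
        apply Rmult_lt_compat_r; [apply Rdiv_lt_0_compat; lra|lra]. }
    exists x; apply theta_inj with k; [apply Hg|exact Hc|].
    rewrite (proj2 (Hg x)), Hx; field; lra.
  - intros x eps He; destruct (near_of_circ_close (proj1 (Hg x)) He) as (d & Hd & Q).
    destruct (@ang_continuous x (d / (INR k / 4))) as (d' & Hd' & Q').
    { apply Rdiv_lt_0_compat; lra. }
    exists d'; split; [exact Hd'|]; intros y Hy; apply Q; [apply Hg|].
    replace d with (d / (INR k / 4) * (INR k / 4)) by (field; lra).
    now apply scale, Q'.
  - intros x eps He; destruct (@ang_inv_continuous x eps He) as (d & Hd & Q).
    exists (d * (INR k / 4)); split; [apply Rmult_lt_0_compat; lra|].
    intros y Hy; apply Q, scale, circ_close_of_near; auto; apply Hg.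
Qed.

(** * Finite cycles are circles *)

Section CycleCircle.
Variables (V E : Type) (ends : E -> V * V).
Variables (k : nat) (vs : nat -> V) (es : nat -> E).
Hypothesis k0 : (0 < k)%nat.
Hypothesis vinj : forall i j, (i < k)%nat -> (j < k)%nat -> vs i = vs j -> i = j.
Hypothesis einj : forall i j, (i < k)%nat -> (j < k)%nat -> es i = es j -> i = j.
Hypothesis J : forall i, (i < k)%nat -> joins ends (es i) (vs i) (vs (S i mod k)).
Hypothesis fsep : finitely_separable ends.

(* The parameter t along the cycle, translated to the orientation of the edge. *)
Definition orient (i : nat) (t : R) : R :=
  if excluded_middle_informative (ends (es i) = (vs i, vs (S i mod k)))
  then t else 1 - t.

Lemma orient_invol i t : orient i (orient i t) = t.
Proof. unfold orient; destruct excluded_middle_informative; lra. Qed.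

Lemma orient_valid i t : 0 < t < 1 -> 0 < orient i t < 1.
Proof. unfold orient; destruct excluded_middle_informative; lra. Qed.

(** Composed with the map of [S1_polygon], this is the embedding of the circle that traces the
    cycle. *)
Definition cyc (c : nat * R) : point ends :=
  if Req_dec_T (snd c) 0 then PV ends (vs (fst c))
  else PE ends (es (fst c)) (orient (fst c) (snd c)).

Lemma cyc_vertex i : cyc (i, 0) = PV ends (vs i).
Proof. unfold cyc; cbn [fst snd]; destruct Req_dec_T; tauto. Qed.

Lemma cyc_inner i t : t <> 0 -> cyc (i, t) = PE ends (es i) (orient i t).
Proof. unfold cyc; cbn [fst snd]; destruct Req_dec_T; tauto. Qed.

Lemma cyc_valid c : coord k c -> valid (cyc c).
Proof.
  intros [_ H]; unfold cyc; destruct Req_dec_T; [exact I|].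
  apply orient_valid; lra.
Qed.

Lemma cyc_inj c c' : coord k c -> coord k c' -> cyc c = cyc c' -> c = c'.
Proof.
  destruct c as [i t], c' as [j s]; intros [L T] [L' T']; unfold cyc; cbn [fst snd] in *.
  destruct (Req_dec_T t 0) as [->|Nt], (Req_dec_T s 0) as [->|Ns]; intros Q;
    try discriminate.
  - injection Q; intros Q1; now rewrite (vinj L L' Q1).
  - injection Q; intros Q2 Q1; apply einj in Q1; [|assumption..]; subst j.
    now rewrite <- (orient_invol i t), Q2, orient_invol.
Qed.

(** Anchors are expressed in the direction of the cycle, so that later arguments need not
    distinguish edge orientations. *)
Lemma anchor_cyc Z i t v : (i < k)%nat ->
  (anchor Z (PE ends (es i) (orient i t)) v <->
   v = vs i /\ (forall s, In (es i, s) Z -> t < orient i s) \/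
   v = vs (S i mod k) /\ (forall s, In (es i, s) Z -> orient i s < t)).
Proof.
  intros L; unfold orient; simpl.
  destruct excluded_middle_informative as [Q|Q].
  - rewrite Q; cbn [fst snd]; intuition congruence.
  - destruct (J L) as [Q'|Q']; [contradiction|]; rewrite Q'; cbn [fst snd].
    split; (intros [[-> H]|[-> H]]; [right|left]); (split; [reflexivity|]);
      intros s Hs; specialize (H s Hs); lra.
Qed.

Lemma cyc_continuous Z x0 c0 : coord k c0 -> validZ Z -> basic Z x0 (cyc c0) ->
  exists eps, 0 < eps /\
    forall c, coord k c -> near k eps c0 c -> basic Z x0 (cyc c).
Proof.
  destruct c0 as [i0 t0]; intros [L0 T0] vZ H; cbn [fst snd] in *.
  destruct (Req_dec t0 0) as [->|N0].
  - rewrite cyc_vertex in H; simpl in H.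
    (* All points of [Z] keep distance [eps] from the ends of their edges, so nearby points on both
       adjacent sides are anchored at [vs i0]. *)
    assert (M : exists eps, 0 < eps < 1 /\ forall z, In z Z -> eps < snd z < 1 - eps).
    { clear H; induction Z as [|z Z' IH]; [exists (/ 2); split; [lra|simpl; tauto]|].
      destruct IH as (m & Hm & IH); [intros y Hy; apply vZ; now right|].
      pose proof (vZ z (or_introl eq_refl)) as Hz.
      exists (Rmin m (Rmin (snd z) (1 - snd z)) / 2).
      assert (P : 0 < Rmin m (Rmin (snd z) (1 - snd z)))
        by (repeat apply Rmin_glb_lt; lra).
      assert (P1 := Rmin_l m (Rmin (snd z) (1 - snd z))).
      assert (P2 := Rmin_r m (Rmin (snd z) (1 - snd z))).
      assert (P3 := Rmin_l (snd z) (1 - snd z)); assert (P4 := Rmin_r (snd z) (1 - snd z)).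
      split; [lra|]; intros y [<-|Hy]; [lra|]; specialize (IH y Hy); lra. }
    destruct M as (eps & Heps & Hz); exists eps; split; [lra|].
    intros [i t] [L T] Hn; cbn [fst snd] in *.
    destruct H as (X0 & _ & [(u & v & Hu & Hv & Ruv)|(e & s & s' & _ & Q & _)]);
      [|discriminate].
    simpl in Hv; subst v.
    assert (Hz' : forall s, In (es i, s) Z -> eps < orient i s < 1 - eps).
    { intros s Hs; apply Hz in Hs; cbn [snd] in Hs; unfold orient.
      destruct excluded_middle_informative; lra. }
    destruct (Req_dec t 0) as [->|Nt].
    + rewrite cyc_vertex; destruct Hn as [[Q _]|(_ & _ & Q)]; cbn [fst snd] in *; [|lra].
      subst i; split; [exact X0|]; split; [exact I|]; left.
      exists u, (vs i0); repeat split; assumption.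
    + rewrite cyc_inner by exact Nt; split; [exact X0|].
      enough (A1 : inXZ Z (PE ends (es i) (orient i t)) /\
                   anchor Z (PE ends (es i) (orient i t)) (vs i0)).
      { split; [apply A1|]; left; exists u, (vs i0); repeat split; try apply A1; assumption. }
      destruct Hn as [[Q Hn]|(_ & Q & Hn)]; cbn [fst snd] in *.
      * subst i; rewrite Rminus_0_r in Hn; apply Rabs_def2 in Hn; split.
        -- split; [apply orient_valid; lra|]; intros Hs; apply Hz' in Hs.
           rewrite orient_invol in Hs; lra.
        -- apply anchor_cyc; [exact L|]; left; split; [reflexivity|].
           intros s Hs; apply Hz' in Hs; lra.
      * split.
        -- split; [apply orient_valid; lra|]; intros Hs; apply Hz' in Hs.
           rewrite orient_invol in Hs; lra.
        -- apply anchor_cyc; [exact L|]; right; split; [now rewrite Q|].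
           intros s Hs; apply Hz' in Hs; lra.
  - rewrite cyc_inner in H by exact N0; simpl in H.
    set (e := es i0) in *; set (s0 := orient i0 t0) in *.
    destruct H as (X0 & [V0 NZ] & H).
    (* Within distance [m] of [s0] the edge carries no point of [Z], so the component does not
       change. *)
    assert (M : exists m, 0 < m /\ forall s, In (e, s) Z -> m < Rabs (s - s0)).
    { clear - NZ; induction Z as [|[x s] Z' IH]; [exists 1; split; [lra|simpl; tauto]|].
      destruct IH as (m & Hm & IH); [intros Q; apply NZ; now right|].
      destruct (classic (x = e)) as [->|Nx].
      - assert (P : 0 < Rabs (s - s0)).
        { apply Rabs_pos_lt; intros Q; apply NZ; left; f_equal; lra. }
        exists (Rmin m (Rabs (s - s0)) / 2).
        assert (P0 : 0 < Rmin m (Rabs (s - s0))) by now apply Rmin_glb_lt.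
        assert (P1 := Rmin_l m (Rabs (s - s0))); assert (P2 := Rmin_r m (Rabs (s - s0))).
        split; [lra|]; intros y [Q|Hy]; [injection Q; intros <-; lra|].
        specialize (IH y Hy); lra.
      - exists m; split; [exact Hm|]; intros y [Q|Hy]; [|auto].
        injection Q; intros _ Q'; contradiction. }
    destruct M as (m & Hm & HmZ).
    exists (Rmin m (Rmin t0 (1 - t0))).
    assert (P1 := Rmin_l m (Rmin t0 (1 - t0))).
    assert (P2 := Rmin_r m (Rmin t0 (1 - t0))).
    assert (P3 := Rmin_l t0 (1 - t0)); assert (P4 := Rmin_r t0 (1 - t0)).
    split; [repeat apply Rmin_glb_lt; lra|].
    intros [i t] [L T] [[Q Hn]|(Q & _)]; cbn [fst snd] in *; [|contradiction]; subst i.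
    assert (Ht : Rabs (t - t0) < m /\ 0 < t) by (split; [|apply Rabs_def2 in Hn]; lra).
    destruct Ht as [Ht Ht0].
    rewrite cyc_inner by lra; fold e; set (s1 := orient i0 t).
    assert (D : Rabs (s1 - s0) < m).
    { unfold s1, s0, orient; destruct excluded_middle_informative; [exact Ht|].
      rewrite <- Rabs_Ropp; replace (- (1 - t - (1 - t0))) with (t - t0) by lra; exact Ht. }
    assert (V1 : 0 < s1 < 1) by (apply orient_valid; lra).
    assert (NB : forall s, In (e, s) Z -> s < s0 /\ s < s1 \/ s0 < s /\ s1 < s).
    { intros s Hs; apply HmZ in Hs; revert Hs D; unfold Rabs.
      destruct (Rcase_abs (s - s0)), (Rcase_abs (s1 - s0)); lra. }
    split; [exact X0|]; split.
    { split; [exact V1|]; intros Hs; apply NB in Hs; lra. }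
    destruct H as [(u & v & Hu & Hv & Ruv)|(x & a & b & Qx & Qb & H)].
    + left; exists u, v; split; [exact Hu|]; split; [|exact Ruv].
      destruct Hv as [[Q Hv]|[Q Hv]]; [left|right]; (split; [exact Q|]);
        intros s Hs; specialize (Hv s Hs); apply NB in Hs; lra.
    + right; injection Qb; intros <- <-; exists e, a, s1.
      split; [exact Qx|]; split; [reflexivity|]; intros r Hr Q; apply (H r Hr).
      apply NB in Hr; revert Q; unfold Rmin, Rmax.
      destruct (Rle_dec a s1), (Rle_dec a s0); lra.
Qed.

(** The union of finite separators of [vs i0] from each other vertex of the cycle. *)
Lemma separating_list i0 : (i0 < k)%nat -> exists L : list E,
  forall j, (j < k)%nat -> reach ends (fun e => In e L) (vs i0) (vs j) -> j = i0.
Proof.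
  intros L0.
  assert (H : forall n, (n <= k)%nat -> exists L : list E, forall j, (j < n)%nat ->
             reach ends (fun e => In e L) (vs i0) (vs j) -> j = i0).
  { induction n as [|n IH]; intros Ln; [exists nil; lia|].
    destruct IH as (l & Hl); [lia|].
    destruct (Nat.eq_dec n i0) as [->|N].
    - exists l; intros j Lj Hr; destruct (Nat.eq_dec j i0); [assumption|].
      apply Hl; [lia|exact Hr].
    - destruct (@fsep (vs i0) (vs n)) as (l' & Hl').
      { intros Q; apply vinj in Q; lia. }
      exists (l ++ l'); intros j Lj Hr; destruct (Nat.eq_dec j n) as [->|Nj].
      + destruct Hl'; apply reach_mono with (F := fun e => In e (l ++ l')); [|exact Hr].
        intros e He; apply in_or_app; now right.
      + apply Hl; [lia|]; apply reach_mono with (F := fun e => In e (l ++ l')); [|exact Hr].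
        intros e He; apply in_or_app; now left. }
  apply (H k); lia.
Qed.

Lemma cyc_neighbourhood c0 eps : coord k c0 -> 0 < eps ->
  exists Z x0, validZ Z /\ inXZ Z x0 /\ basic Z x0 (cyc c0) /\
    forall c, coord k c -> basic Z x0 (cyc c) -> near k eps c0 c.
Proof.
  destruct c0 as [i0 t0]; intros [L0 T0] He; cbn [fst snd] in *.
  destruct (Req_dec t0 0) as [->|N0].
  - destruct (separating_list L0) as (l & Hl).
    set (d := Rmin eps (/ 2) / 2).
    assert (Hd : 0 < d < / 2 /\ d < eps).
    { assert (0 < Rmin eps (/ 2)) by (apply Rmin_glb_lt; lra).
      pose proof (Rmin_l eps (/ 2)); pose proof (Rmin_r eps (/ 2)); unfold d; lra. }
    (* Cutting the edges of [l] keeps the other cycle vertices out of the component of [vs i0].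
       Cutting each cycle edge at distance [d] from both ends leaves only short pieces at that
       vertex. *)
    set (Z := map (fun e => (e, / 2)) l ++
              map (fun i => (es i, orient i d)) (seq 0 k) ++
              map (fun i => (es i, orient i (1 - d))) (seq 0 k)).
    exists Z, (PV ends (vs i0)).
    assert (ZL : forall e, In e l -> cutE Z e).
    { intros e He'; exists (/ 2); apply in_or_app; left.
      now apply (in_map (fun e => (e, / 2))). }
    assert (Zd : forall i, (i < k)%nat ->
              In (es i, orient i d) Z /\ In (es i, orient i (1 - d)) Z).
    { intros i Li; assert (Hi : In i (seq 0 k)) by (apply in_seq; lia).
      split; apply in_or_app; right; apply in_or_app; [left|right].
      - now apply (in_map (fun i => (es i, orient i d))).
      - now apply (in_map (fun i => (es i, orient i (1 - d)))). }
    split; [|split; [exact I|split]].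
    + intros z Hz; unfold Z in Hz; rewrite !in_app_iff in Hz.
      destruct Hz as [Hz|[Hz|Hz]];
        apply in_map_iff in Hz; destruct Hz as (y & <- & _); cbn [snd];
        [lra|apply orient_valid; lra..].
    + rewrite cyc_vertex; split; [exact I|]; split; [exact I|]; left.
      exists (vs i0), (vs i0); repeat split; constructor.
    + intros [i t] [L T] H; cbn [fst snd] in *.
      assert (Hr : forall j, (j < k)%nat -> reach ends (cutE Z) (vs i0) (vs j) -> j = i0).
      { intros j Lj R; apply Hl; [exact Lj|].
        apply reach_mono with (F := cutE Z); assumption. }
      destruct (Req_dec t 0) as [->|Nt].
      * rewrite cyc_vertex in H.
        destruct H as (_ & _ & [(u & v & Hu & Hv & R)|(e & s & s' & Q & _)]);
          [|discriminate].
        simpl in Hu, Hv; subst u v; apply Hr in R; [|exact L].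
        left; cbn [fst snd]; split; [exact R|]; now rewrite Rminus_0_r, Rabs_R0.
      * rewrite cyc_inner in H by exact Nt.
        destruct H as (_ & _ & [(u & v & Hu & Hv & R)|(e & s & s' & Q & _)]);
          [|discriminate].
        simpl in Hu; subst u; apply anchor_cyc in Hv; [|exact L].
        destruct (Zd i L) as [Z1 Z2].
        destruct Hv as [[-> Hv]|[-> Hv]].
        -- apply Hr in R; [|exact L]; apply Hv in Z1; rewrite orient_invol in Z1.
           left; cbn [fst snd]; split; [exact R|]; apply Rabs_def1; lra.
        -- apply Hr in R; [|apply Nat.mod_upper_bound; lia].
           apply Hv in Z2; rewrite orient_invol in Z2.
           right; cbn [fst snd]; split; [reflexivity|]; split; [exact R|lra].
  - set (d := Rmin eps (Rmin t0 (1 - t0)) / 2).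
    assert (Hd : 0 < d /\ d < eps /\ d < t0 /\ d < 1 - t0).
    { assert (0 < Rmin eps (Rmin t0 (1 - t0))) by (repeat apply Rmin_glb_lt; lra).
      pose proof (Rmin_l eps (Rmin t0 (1 - t0))); pose proof (Rmin_r eps (Rmin t0 (1 - t0))).
      pose proof (Rmin_l t0 (1 - t0)); pose proof (Rmin_r t0 (1 - t0)); unfold d; lra. }
    (* The two cuts isolate a segment of length 2d around the point, away from both ends of the
       edge. *)
    set (Z := (es i0, orient i0 (t0 - d)) :: (es i0, orient i0 (t0 + d)) :: nil).
    assert (Z1 : In (es i0, orient i0 (t0 - d)) Z) by now left.
    assert (Z2 : In (es i0, orient i0 (t0 + d)) Z) by (right; now left).
    assert (NZ : ~ In (es i0, orient i0 t0) Z).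
    { intros [Q|[Q|[]]]; injection Q; intros Q';
        apply (f_equal (orient i0)) in Q'; rewrite !orient_invol in Q'; lra. }
    exists Z, (cyc (i0, t0)).
    assert (IX : inXZ Z (cyc (i0, t0))).
    { rewrite cyc_inner by exact N0; split; [apply orient_valid; lra|exact NZ]. }
    split; [|split; [exact IX|split]].
    + intros z [<-|[<-|[]]]; cbn [snd]; apply orient_valid; lra.
    + rewrite cyc_inner in * by exact N0; split; [exact IX|]; split; [exact IX|].
      right; do 3 eexists; split; [reflexivity|]; split; [reflexivity|].
      intros r Hr Q; apply NZ.
      replace (orient i0 t0) with r; [exact Hr|].
      revert Q; unfold Rmin, Rmax; destruct Rle_dec; lra.
    + intros [i t] [L T] H; cbn [fst snd] in *.
      rewrite (cyc_inner i0 N0) in H.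
      (* [cyc] never takes an edge-end as value, so [basic] reduces to [samecomp]. *)
      assert (H' : samecomp Z (PE ends (es i0) (orient i0 t0)) (cyc (i, t))).
      { unfold cyc in H |- *; destruct Req_dec_T; exact H. }
      clear H; destruct H' as (_ & _ & [(u & v & Hu & _)|(e & s & s' & Q & Q' & H)]).
      * exfalso; apply anchor_cyc in Hu; [|exact L0].
        destruct Hu as [[_ Hu]|[_ Hu]].
        -- apply Hu in Z1; rewrite orient_invol in Z1; lra.
        -- apply Hu in Z2; rewrite orient_invol in Z2; lra.
      * injection Q; intros <- <-; clear Q.
        destruct (Req_dec t 0) as [->|Nt]; [rewrite cyc_vertex in Q'; discriminate|].
        rewrite cyc_inner in Q' by exact Nt; injection Q'; intros Q2 Q1.
        apply einj in Q1; [|assumption..]; subst i s'.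
        left; cbn [fst snd]; split; [reflexivity|].
        pose proof (H _ Z1) as H1; pose proof (H _ Z2) as H2.
        clear - H1 H2 Hd T T0; apply Rnot_le_lt; intros N.
        revert H1 H2 N; unfold orient, Rmin, Rmax, Rabs.
        destruct excluded_middle_informative;
          destruct Rle_dec, Rcase_abs; intros H1 H2 N; try lra;
          ((apply H1; lra) || (apply H2; lra)).
Qed.

Lemma cycle_is_circle :
  is_circle_edges ends (fun e => exists i, (i < k)%nat /\ es i = e).
Proof.
  destruct (S1_polygon k0) as (g & gc & gonto & g1 & g2).
  exists (fun p => exists x, cyc (g x) = p); split.
  - exists (fun x => cyc (g x)); split; [|split; [|split; [|split]]].
    + intros x; apply cyc_valid, gc.
    + intros x y Q; apply cyc_inj in Q; [|apply gc..].
      (* Equal polygon coordinates make [x] and [y] arbitrarily close. *)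
      assert (H : forall eps, 0 < eps -> close eps x y).
      { intros eps He; destruct (g2 x eps He) as (d & Hd & Hy); apply Hy.
        left; rewrite Q; split; [reflexivity|].
        now replace (snd (g y) - snd (g y)) with 0 by lra; rewrite Rabs_R0. }
      apply S1_eq; apply NNPP; intros N; apply Rminus_eq_contra, Rabs_pos_lt in N;
        destruct (H _ N) as [H1 H2]; lra.
    + intros U oU x Ux; destruct (oU _ Ux) as (Z & x0 & vZ & _ & Hb & sub).
      destruct (cyc_continuous _ (gc x) vZ Hb) as (eps & He & Hn).
      destruct (g1 x eps He) as (d & Hd & Hy); exists d; split; [exact Hd|].
      intros y Y1 Y2; apply sub, Hn; [apply gc|]; apply Hy; now split.
    + intros U oU.
      (* The union of all basic open sets whose trace on the circle lies in [U]. *)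
      exists (fun p => exists Z x0, validZ Z /\ inXZ Z x0 /\ basic Z x0 p /\
                forall y, basic Z x0 (cyc (g y)) -> U y).
      split.
      * intros p (Z & x0 & vZ & X0 & Hb & HU); exists Z, x0.
        repeat (split; [assumption|]); intros q Hq; exists Z, x0; auto.
      * intros x; split.
        -- intros Ux; destruct (oU x Ux) as (eps & He & H).
           destruct (g2 x eps He) as (d & Hd & Hy).
           destruct (cyc_neighbourhood (gc x) Hd) as (Z & x0 & vZ & X0 & Hb & Hn).
           exists Z, x0; repeat (split; [assumption|]); intros y By.
           destruct (Hy y (Hn _ (gc y) By)); auto.
        -- intros (Z & x0 & _ & _ & Hb & HU); auto.
    + intros p; tauto.
  - intros e; split.
    + intros (i & Li & <-) t Ht; pose proof (orient_valid i Ht) as Ht'.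
      destruct (gonto (i, orient i t)) as (x & Hx); [split; [exact Li|simpl; lra]|].
      exists x; rewrite Hx, cyc_inner by lra; now rewrite orient_invol.
    + intros H; destruct (H (/ 2) ltac:(lra)) as (x & Hx).
      exists (fst (g x)); split; [apply gc|].
      unfold cyc in Hx; destruct Req_dec_T; [discriminate|].
      now injection Hx.
Qed.
End CycleCircle.

Lemma finite_cycle_circle (V E : Type) (ends : E -> V * V) (D : eset E) :
  finitely_separable ends -> is_finite_cycle_edges ends D -> is_circle_edges ends D.
Proof.
  intros fsep (k & vs & es & k0 & vinj & einj & J & HD).
  replace D with (fun e => exists i, (i < k)%nat /\ es i = e).
  - now apply cycle_is_circle with vs.
  - apply functional_extensionality; intros e; apply propositional_extensionality.
    symmetry; apply HD.
Qed.

(** * Duality *)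

Lemma dual_FB_FC (V Vs E : Type) (ends : E -> V * V) (endss : E -> Vs * Vs) :
  finitely_separable ends -> is_dual_id ends endss ->
  forall X, M_FB ends X <-> M_FC endss X.
Proof.
  intros fsep dl X; split.
  - intros I D C sub; destruct (cycle_nonempty C) as (e & De).
    destruct (classic (spans ends (fun x => ~ D x) e)) as [S|NS].
    (* The path avoiding [D] closes up with [e] to a cycle [D'] that meets [D] only in [e]. *)
    + destruct (@cycle_through _ _ ends (fun x => ~ D x) e) as (D' & C' & D'e & sub');
        [tauto|exact S|].
      apply (finite_cycle_circle fsep), dl in C'; destruct C' as [cut _].
      destruct (spans_cut cut D'e (cycle_spans _ C De)) as (x & D'x & Dx & Nx).
      destruct (sub' x D'x); contradiction.
    + destruct (bond_through NS) as (B & HB & Be & BD).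
      assert (BsubD : subset B D) by (intros x Bx; now apply NNPP, BD).
      apply (I B).
      * split; [exact HB|]; destruct (cycle_finite C) as (l & Hl); exists l; auto.
      * intros x Bx; auto.
  - intros I F [HF fin] sub; destruct HF as [cut [(e & Fe) mn]].
    assert (IF : M_FC endss F) by (apply FC_subset with X; assumption).
    (* The fundamental bond of [e] in G* meets [F] only in [e], and duality makes it a circle of
       G. *)
    destruct (FC_fundamental_bond _ IF Fe) as (D & BD & De & uniq).
    apply dl in BD.
    destruct (circle_finite_cut _ BD cut fin De Fe) as (x & Dx & Fx & Nx); auto.
Qed.

Theorem theorem3p4 (V Vs E : Type) (ends : E -> V * V) (endss : E -> Vs * Vs) :
  countable V -> countable Vs -> countable E ->
  finitely_separable ends -> finitely_separable endss ->
  is_dual_id ends endss ->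
  is_matroid (M_FB ends) /\ is_matroid (M_C ends) /\
  is_matroid (M_B endss) /\ is_matroid (M_FC endss) /\
  same_matroid (M_FB ends) (dual (M_C ends)) /\
  same_matroid (dual (M_C ends)) (dual (M_B endss)) /\
  same_matroid (dual (M_B endss)) (M_FC endss).
Proof.
  intros _ _ cE fsep _ dl.
  (* Duality says that both matroids have the same circuits. *)
  assert (CB : M_C ends = M_B endss).
  { unfold M_C, M_B; f_equal; apply functional_extensionality; intros F.
    apply propositional_extensionality, dl. }
  assert (FBFC : M_FB ends = M_FC endss).
  { apply functional_extensionality; intros X.
    now apply propositional_extensionality, dual_FB_FC. }
  rewrite CB, FBFC.
  repeat split; try (apply FC_matroid, cE); try (apply B_matroid, cE);
    try (apply dual_B, cE); auto.
Qed.
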